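(* (GBC) For any class $A$, if there is a truth predicate for the infinitary language $\mathcal L_{\mathrm{Ord},\omega}(\in,A)$, then there is an $\mathrm{Ord}$-iterated truth predicate in the first-order language $\mathcal L_{\omega,\omega}(\in,\hat{\mathrm{Tr}},A)$.
   Context: $\mathcal L_{\mathrm{Ord},\omega}(\in,\hat A)$: formulas built from $x=y$, $x\in y$, $x\in\hat A$ by negation, set-sized conjunctions with finitely many free variables in total, and universal quantifiers. A truth predicate for it is a class $\mathbb T$ of pairs $\langle\varphi,\vec a\rangle$ ($\vec a$ a valuation of the free variables) with: $\mathbb T(x=y,\langle a,b\rangle)$ iff $a=b$; $\mathbb T(x\in y,\langle a,b\rangle)$ iff $a\in b$; $\mathbb T(x\in\hat A,a)$ iff $a\in A$; $\mathbb T(\bigwedge_i\varphi_i,\vec a)$ iff all $\mathbb T(\varphi_i,\vec a)$; $\mathbb T(\neg\varphi,\vec a)$ iff not $\mathbb T(\varphi,\vec a)$; $\mathbb T(\forall x\varphi,\vec a)$ iff $\mathbb T(\varphi,b^\frown\vec a)$ for all $b$. $\mathcal L_{\omega,\omega}(\in,\hat{\mathrm{Tr}},A)$ is the first-order language with $\in$, a unary predicate $\hat A$, and a ternary predicate $\hat{\mathrm{Tr}}$. An $\mathrm{Ord}$-iterated truth predicate for it is a class $\mathrm{Tr}$ of triples $\langle\beta,\varphi,\vec a\rangle$, $\beta$ an ordinal, $\varphi$ a formula of this language, $\vec a$ a valuation of its free variables, such that for all $\beta$: $\mathrm{Tr}(\beta,x=y,\langle a,b\rangle)$ iff $a=b$;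 $\mathrm{Tr}(\beta,x\in y,\langle a,b\rangle)$ iff $a\in b$; $\mathrm{Tr}(\beta,x\in\hat A,a)$ iff $a\in A$; $\mathrm{Tr}(\beta,\hat{\mathrm{Tr}}(x,y,z),\langle\alpha,\varphi,\vec a\rangle)$ iff $\alpha<\beta$ and $\mathrm{Tr}(\alpha,\varphi,\vec a)$; $\mathrm{Tr}(\beta,\varphi\wedge\psi,\vec a)$ iff both $\mathrm{Tr}(\beta,\varphi,\vec a)$ and $\mathrm{Tr}(\beta,\psi,\vec a)$; $\mathrm{Tr}(\beta,\neg\varphi,\vec a)$ iff not $\mathrm{Tr}(\beta,\varphi,\vec a)$; $\mathrm{Tr}(\beta,\forall x\varphi,\vec a)$ iff $\mathrm{Tr}(\beta,\varphi,b^\frown\vec a)$ for all $b$. *)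

(* Defs.v *)
(* Only Stdlib is used.  The theory GBC is rendered by quantifying over its
   models: two-sorted structures of sets and classes.  Such a model may be
   externally ill-founded (its omega may be nonstandard), so formulas,
   finiteness, valuations and ordinals of the object languages are all defined
   internally to the model, never by Rocq inductive types or Rocq's nat. *)
From Stdlib Require Import ClassicalEpsilon.

Set Implicit Arguments.
Unset Strict Implicit.
Unset Printing Implicit Defensive.

Record structure : Type := Structure {
  sets : Type;
  classes : Type;
  mem : sets -> sets -> Prop;
  cmem : sets -> classes -> Prop
}.

Declare Scope gbc_scope.
Delimit Scope gbc_scope with gbc.
Open Scope gbc_scope.

Notation "x ∈ y" := (mem x y) (at level 70, no associativity) : gbc_scope.
Notation "x ∈c X" := (cmem x X) (at level 70, no associativity) : gbc_scope.

(* Formulas with class parameters and without class quantifiers; set variables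
   are de Bruijn indices. *)
Inductive fo (C : Type) : Type :=
| FoEq (i j : nat)
| FoIn (i j : nat)
| FoCls (i : nat) (X : C)
| FoNeg (f : fo C)
| FoAnd (f g : fo C)
| FoAll (f : fo C).

Definition scons (V : Type) (b : V) (e : nat -> V) : nat -> V :=
  fun n => match n with 0 => b | S m => e m end.

Fixpoint fo_eval (M : structure) (e : nat -> sets M) (f : fo (classes M))
  : Prop :=
  match f with
  | FoEq _ i j => e i = e j
  | FoIn _ i j => e i ∈ e j
  | FoCls i X => e i ∈c X
  | FoNeg f => ~ fo_eval e f
  | FoAnd f g => fo_eval e f /\ fo_eval e g
  | FoAll f => forall b, fo_eval (scons b e) f
  end.

Definition is_empty (M : structure) (x : sets M) : Prop :=
  forall z, ~ z ∈ x.

Definition is_upair (M : structure) (p x y : sets M) : Prop :=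
  forall z, z ∈ p <-> z = x \/ z = y.

(* Kuratowski pair {{x}, {x, y}}. *)
Definition is_opair (M : structure) (p x y : sets M) : Prop :=
  exists u v, is_upair u x x /\ is_upair v x y /\ is_upair p u v.

Definition is_succ (M : structure) (s x : sets M) : Prop :=
  forall z, z ∈ s <-> z ∈ x \/ z = x.

Definition is_inductive (M : structure) (w : sets M) : Prop :=
  (exists e, is_empty e /\ e ∈ w) /\
  (forall x, x ∈ w -> exists s, is_succ s x /\ s ∈ w).

Definition class_rel (M : structure) (F : classes M) (x y : sets M) : Prop :=
  exists p, is_opair p x y /\ p ∈c F.

Definition class_functional (M : structure) (F : classes M) : Prop :=
  forall x y y', class_rel F x y -> class_rel F x y' -> y = y'.

Record is_GBC (M : structure) : Prop := {
  set_extensionality : forall x y : sets M,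
    (forall z, z ∈ x <-> z ∈ y) -> x = y;
  class_extensionality : forall X Y : classes M,
    (forall z, z ∈c X <-> z ∈c Y) -> X = Y;
  pairing : forall x y : sets M, exists p, is_upair p x y;
  union_set : forall x : sets M, exists u,
    forall z, z ∈ u <-> exists y, y ∈ x /\ z ∈ y;
  power_set : forall x : sets M, exists p,
    forall z, z ∈ p <-> (forall w, w ∈ z -> w ∈ x);
  infinity : exists w : sets M, is_inductive w;
  class_regularity : forall X : classes M,
    (exists x, x ∈c X) ->
    exists x, x ∈c X /\ forall z, z ∈ x -> ~ z ∈c X;
  comprehension : forall (f : fo (classes M)) (e : nat -> sets M),
    exists X, forall x, x ∈c X <-> fo_eval (scons x e) f;
  class_replacement : forall (F : classes M) (a : sets M),
    class_functional F ->
    exists b, forall y, y ∈ b <-> exists x, x ∈ a /\ class_rel F x y;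
  global_choice : exists F : classes M, class_functional F /\
    forall x : sets M, ~ is_empty x -> exists y, y ∈ x /\ class_rel F x y
}.

Record GBC_model : Type := {
  GBC_structure :> structure;
  GBC_axioms : is_GBC GBC_structure
}.

Lemma empty_exists (M : GBC_model) : exists e : sets M, is_empty e.
Proof.
destruct (infinity (GBC_axioms M)) as [w [[e [He _]] _]].
exists e; exact He.
Qed.

Definition empty (M : GBC_model) : sets M :=
  proj1_sig (constructive_indefinite_description _ (empty_exists M)).

Definition upair (M : GBC_model) (x y : sets M) : sets M :=
  proj1_sig (constructive_indefinite_description _
    (pairing (GBC_axioms M) x y)).

Definition union (M : GBC_model) (x : sets M) : sets M :=
  proj1_sig (constructive_indefinite_description _
    (union_set (GBC_axioms M) x)).

Definition opair (M : GBC_model) (x y : sets M) : sets M :=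
  upair (upair x x) (upair x y).

Notation "⟨ x , y ⟩" := (opair x y) (at level 0) : gbc_scope.
Notation "⟨ x , y , z ⟩" := (opair x (opair y z)) (at level 0) : gbc_scope.

(* [adjoin a x] is a ∪ {x}. *)
Definition adjoin (M : GBC_model) (a x : sets M) : sets M :=
  union (upair a (upair x x)).

Fixpoint numeral (M : GBC_model) (n : nat) : sets M :=
  match n with
  | 0 => empty M
  | S m => adjoin (numeral M m) (numeral M m)
  end.

(* Membership in the omega of the model. *)
Definition is_natural (M : GBC_model) (n : sets M) : Prop :=
  forall w, is_inductive w -> n ∈ w.

(* Well-foundedness of ∈ is provided by regularity. *)
Definition is_ordinal (M : GBC_model) (x : sets M) : Prop :=
  (forall y z, z ∈ y -> y ∈ x -> z ∈ x) /\
  (forall y z, y ∈ x -> z ∈ x -> y ∈ z \/ y = z \/ z ∈ y).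

Definition subset (M : GBC_model) (x y : sets M) : Prop :=
  forall z, z ∈ x -> z ∈ y.

Definition is_function (M : GBC_model) (f : sets M) : Prop :=
  (forall p, p ∈ f -> exists x y, p = ⟨x, y⟩) /\
  (forall x y y', ⟨x, y⟩ ∈ f -> ⟨x, y'⟩ ∈ f -> y = y').

Definition is_bijection (M : GBC_model) (f a b : sets M) : Prop :=
  is_function f /\
  (forall x, (exists y, ⟨x, y⟩ ∈ f) <-> x ∈ a) /\
  (forall y, (exists x, ⟨x, y⟩ ∈ f) <-> y ∈ b) /\
  (forall x x' y, ⟨x, y⟩ ∈ f -> ⟨x', y⟩ ∈ f -> x = x').

Definition is_finite (M : GBC_model) (s : sets M) : Prop :=
  exists n f, is_natural n /\ is_bijection f n s.

(* Codes of formulas.  A variable is an element of the omega of the model. *)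
Definition cEq (M : GBC_model) (x y : sets M) := ⟨numeral M 0, x, y⟩.
Definition cIn (M : GBC_model) (x y : sets M) := ⟨numeral M 1, x, y⟩.
Definition cA (M : GBC_model) (x : sets M) := ⟨numeral M 2, x⟩.
Definition cNeg (M : GBC_model) (φ : sets M) := ⟨numeral M 3, φ⟩.
Definition cAll (M : GBC_model) (x φ : sets M) := ⟨numeral M 4, x, φ⟩.
(* Conjunction of all the members of the set Φ. *)
Definition cConj (M : GBC_model) (Φ : sets M) := ⟨numeral M 5, Φ⟩.
Definition cAnd (M : GBC_model) (φ ψ : sets M) := ⟨numeral M 6, φ, ψ⟩.
Definition cTr (M : GBC_model) (x y z : sets M) :=
  ⟨numeral M 7, ⟨x, y, z⟩⟩.

Definition free_closed (M : GBC_model) (R : classes M) : Prop :=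
  (forall x y, ⟨x, cEq x y⟩ ∈c R /\ ⟨y, cEq x y⟩ ∈c R) /\
  (forall x y, ⟨x, cIn x y⟩ ∈c R /\ ⟨y, cIn x y⟩ ∈c R) /\
  (forall x, ⟨x, cA x⟩ ∈c R) /\
  (forall x y z, ⟨x, cTr x y z⟩ ∈c R /\ ⟨y, cTr x y z⟩ ∈c R /\
                 ⟨z, cTr x y z⟩ ∈c R) /\
  (forall v φ, ⟨v, φ⟩ ∈c R -> ⟨v, cNeg φ⟩ ∈c R) /\
  (forall v φ Φ, φ ∈ Φ -> ⟨v, φ⟩ ∈c R -> ⟨v, cConj Φ⟩ ∈c R) /\
  (forall v φ ψ, ⟨v, φ⟩ ∈c R \/ ⟨v, ψ⟩ ∈c R -> ⟨v, cAnd φ ψ⟩ ∈c R) /\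
  (forall v x φ, ⟨v, φ⟩ ∈c R -> v <> x -> ⟨v, cAll x φ⟩ ∈c R).

(* The variable v occurs free in φ: least relation with the closure properties
   above, for the codes of both languages at once. *)
Definition free (M : GBC_model) (v φ : sets M) : Prop :=
  forall R : classes M, free_closed R -> ⟨v, φ⟩ ∈c R.

Definition finitely_many_free (M : GBC_model) (Φ : sets M) : Prop :=
  exists s, is_finite s /\ forall v φ, φ ∈ Φ -> free v φ -> v ∈ s.

Definition inf_closed (M : GBC_model) (X : classes M) : Prop :=
  (forall x y, is_natural x -> is_natural y -> cEq x y ∈c X) /\
  (forall x y, is_natural x -> is_natural y -> cIn x y ∈c X) /\
  (forall x, is_natural x -> cA x ∈c X) /\
  (forall φ, φ ∈c X -> cNeg φ ∈c X) /\
  (forall Φ, (forall φ, φ ∈ Φ -> φ ∈c X) -> finitely_many_free Φ ->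
     cConj Φ ∈c X) /\
  (forall x φ, is_natural x -> φ ∈c X -> cAll x φ ∈c X).

(* Formulas of L_{Ord,ω}(∈, Â). *)
Definition inf_formula (M : GBC_model) (φ : sets M) : Prop :=
  forall X : classes M, inf_closed X -> φ ∈c X.

Definition fin_closed (M : GBC_model) (X : classes M) : Prop :=
  (forall x y, is_natural x -> is_natural y -> cEq x y ∈c X) /\
  (forall x y, is_natural x -> is_natural y -> cIn x y ∈c X) /\
  (forall x, is_natural x -> cA x ∈c X) /\
  (forall x y z, is_natural x -> is_natural y -> is_natural z ->
     cTr x y z ∈c X) /\
  (forall φ, φ ∈c X -> cNeg φ ∈c X) /\
  (forall φ ψ, φ ∈c X -> ψ ∈c X -> cAnd φ ψ ∈c X) /\
  (forall x φ, is_natural x -> φ ∈c X -> cAll x φ ∈c X).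

(* Formulas of L_{ω,ω}(∈, Tr, A). *)
Definition fin_formula (M : GBC_model) (φ : sets M) : Prop :=
  forall X : classes M, fin_closed X -> φ ∈c X.

(* Functions whose domain is exactly the set of free variables of φ. *)
Definition is_valuation (M : GBC_model) (a φ : sets M) : Prop :=
  is_function a /\ forall v, (exists b, ⟨v, b⟩ ∈ a) <-> free v φ.

(* The truth value which T assigns to φ under the function a, whose domain may
   properly contain the free variables of φ: a is first restricted to them. *)
Definition true_at (M : GBC_model) (T : classes M) (φ a : sets M) : Prop :=
  exists a', is_valuation a' φ /\ subset a' a /\ ⟨φ, a'⟩ ∈c T.

Definition iterated_true_at (M : GBC_model) (Tr : classes M) (β φ a : sets M)
  : Prop :=
  exists a', is_valuation a' φ /\ subset a' a /\ ⟨β, φ, a'⟩ ∈c Tr.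

(* In the quantifier clauses x is not in the domain of a, so that
   a ∪ {⟨x, b⟩} is again a function. *)
Record is_truth_predicate (M : GBC_model) (A T : classes M) : Prop := {
  truth_pairs : forall t, t ∈c T ->
    exists φ a, t = ⟨φ, a⟩ /\ inf_formula φ /\ is_valuation a φ;
  truth_eq : forall x y a, inf_formula (cEq x y) -> is_valuation a (cEq x y) ->
    (⟨cEq x y, a⟩ ∈c T <-> exists b c, ⟨x, b⟩ ∈ a /\ ⟨y, c⟩ ∈ a /\ b = c);
  truth_in : forall x y a, inf_formula (cIn x y) -> is_valuation a (cIn x y) ->
    (⟨cIn x y, a⟩ ∈c T <-> exists b c, ⟨x, b⟩ ∈ a /\ ⟨y, c⟩ ∈ a /\ b ∈ c);
  truth_A : forall x a, inf_formula (cA x) -> is_valuation a (cA x) ->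
    (⟨cA x, a⟩ ∈c T <-> exists b, ⟨x, b⟩ ∈ a /\ b ∈c A);
  truth_conj : forall Φ a, inf_formula (cConj Φ) -> is_valuation a (cConj Φ) ->
    (⟨cConj Φ, a⟩ ∈c T <-> forall φ, φ ∈ Φ -> true_at T φ a);
  truth_neg : forall φ a, inf_formula (cNeg φ) -> is_valuation a (cNeg φ) ->
    (⟨cNeg φ, a⟩ ∈c T <-> ~ ⟨φ, a⟩ ∈c T);
  truth_all : forall x φ a,
    inf_formula (cAll x φ) -> is_valuation a (cAll x φ) ->
    (⟨cAll x φ, a⟩ ∈c T <-> forall b, true_at T φ (adjoin a ⟨x, b⟩))
}.

Record is_iterated_truth_predicate (M : GBC_model) (A Tr : classes M) : Prop :=
{
  iter_triples : forall t, t ∈c Tr ->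
    exists β φ a, t = ⟨β, φ, a⟩ /\ is_ordinal β /\ fin_formula φ /\
      is_valuation a φ;
  iter_eq : forall β x y a, is_ordinal β ->
    fin_formula (cEq x y) -> is_valuation a (cEq x y) ->
    (⟨β, cEq x y, a⟩ ∈c Tr <->
     exists b c, ⟨x, b⟩ ∈ a /\ ⟨y, c⟩ ∈ a /\ b = c);
  iter_in : forall β x y a, is_ordinal β ->
    fin_formula (cIn x y) -> is_valuation a (cIn x y) ->
    (⟨β, cIn x y, a⟩ ∈c Tr <->
     exists b c, ⟨x, b⟩ ∈ a /\ ⟨y, c⟩ ∈ a /\ b ∈ c);
  iter_A : forall β x a, is_ordinal β ->
    fin_formula (cA x) -> is_valuation a (cA x) ->
    (⟨β, cA x, a⟩ ∈c Tr <-> exists b, ⟨x, b⟩ ∈ a /\ b ∈c A);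
  iter_Tr : forall β x y z a, is_ordinal β ->
    fin_formula (cTr x y z) -> is_valuation a (cTr x y z) ->
    (⟨β, cTr x y z, a⟩ ∈c Tr <->
     exists α φ c, ⟨x, α⟩ ∈ a /\ ⟨y, φ⟩ ∈ a /\ ⟨z, c⟩ ∈ a /\
       α ∈ β /\ ⟨α, φ, c⟩ ∈c Tr);
  iter_and : forall β φ ψ a, is_ordinal β ->
    fin_formula (cAnd φ ψ) -> is_valuation a (cAnd φ ψ) ->
    (⟨β, cAnd φ ψ, a⟩ ∈c Tr <->
     iterated_true_at Tr β φ a /\ iterated_true_at Tr β ψ a);
  iter_neg : forall β φ a, is_ordinal β ->
    fin_formula (cNeg φ) -> is_valuation a (cNeg φ) ->
    (⟨β, cNeg φ, a⟩ ∈c Tr <-> ~ ⟨β, φ, a⟩ ∈c Tr);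
  iter_all : forall β x φ a, is_ordinal β ->
    fin_formula (cAll x φ) -> is_valuation a (cAll x φ) ->
    (⟨β, cAll x φ, a⟩ ∈c Tr <->
     forall b, iterated_true_at Tr β φ (adjoin a ⟨x, b⟩))
}.

(* Main.v *)
(* Over a stage β, every first-order formula φ is translated into an infinitary
   formula tr β φ whose only free variable v_0 stands for the whole valuation of
   φ; then Tr(β, φ, a) is defined as T(tr β φ, a).  Every set c is definable by
   an infinitary formula, by recursion on c, so the atomic formula Tr(x, y, z)
   can be translated by the set-sized disjunction, over all α in β and all
   first-order φ, of: v_0(x) = α, v_0(y) = φ, and v_0(z) is a valuation of φ
   which satisfies tr α φ.  The translation of a compound formula passes to the
   valuations of its components by quantifying over them, and renames variables
   by the trick ∃v_0 (v_0 = v_j ∧ ...), so that eight variables suffice.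

   The model may be ill-founded from outside: induction is available only for
   definable predicates, and recursion has to be carried out inside the model. *)
From Stdlib Require Import Classical ClassicalEpsilon Arith Lia List.
Require Import Defs.
Import ListNotations.

(** Comprehension admits no class quantifiers, so GBC does not in general allow a recursion of
    length Ord whose stages are proper classes, and the stages of Tr cannot be built one from
    another. What is iterated is the translation: its stages are sets of formulas, ordinary set
    recursion suffices for them, and [T] evaluates all of them at once at the end.

    Packing a valuation into one variable is also what makes the disjunctions legitimate: the
    first-order formulas of the model have unboundedly many free variables, whereas an infinitary
    conjunction may have only finitely many in total.

    The limit on comprehension shapes the preliminaries as well. [free], [fin_formula] and
    [inf_formula] quantify over classes. The first is replaced by the existence of a set of
    justified pairs, the second by membership in a set of hereditarily finite codes, the third by
    the occurrence of the formula or its negation in [T].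

    As to the number eight: v_1 to v_4 serve the clauses of the translation, v_5 holds a pair, and
    v_6 and v_7 unfold the definition of Kuratowski pairs. *)

Section Definability.
Context {M : GBC_model}.
Notation V := (sets M).
Notation env := (nat -> sets M).

(** * Extensionality and ordered pairs *)

Lemma ext (x y : V) : (forall z, z ∈ x <-> z ∈ y) -> x = y.
Proof. exact (set_extensionality (GBC_axioms M) (x := x) (y := y)). Qed.

Lemma in_upair (x y z : V) : z ∈ upair x y <-> z = x \/ z = y.
Proof.
unfold upair.
destruct (constructive_indefinite_description _ _) as [p Hp]; exact (Hp z).
Qed.

Lemma in_union (x z : V) : z ∈ union x <-> exists y, y ∈ x /\ z ∈ y.
Proof.
unfold union.
destruct (constructive_indefinite_description _ _) as [p Hp]; exact (Hp z).
Qed.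

Lemma in_empty (z : V) : ~ z ∈ empty M.
Proof.
unfold empty.
destruct (constructive_indefinite_description _ _) as [p Hp]; exact (Hp z).
Qed.

Lemma in_adjoin (a x z : V) : z ∈ adjoin a x <-> z ∈ a \/ z = x.
Proof.
unfold adjoin; rewrite in_union; split.
- intros [y [Hy Hz]]; apply in_upair in Hy as [-> | ->]; [now left |].
  apply in_upair in Hz as [-> | ->]; now right.
- intros [H | ->].
  + exists a; rewrite in_upair; auto.
  + exists (upair x x); rewrite !in_upair; auto.
Qed.

Lemma upair_char (p x y : V) : is_upair p x y <-> p = upair x y.
Proof.
split.
- intro H; apply ext; intro z; rewrite in_upair; apply H.
- intros -> z; apply in_upair.
Qed.

Lemma opair_char (p x y : V) : is_opair p x y <-> p = ⟨x, y⟩.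
Proof.
unfold is_opair, opair; split.
- intros (u & v & Hu & Hv & Hp).
  apply upair_char in Hu, Hv, Hp; now subst.
- intros ->; exists (upair x x), (upair x y); now rewrite !upair_char.
Qed.

Lemma opair_inj (x y x' y' : V) : ⟨x, y⟩ = ⟨x', y'⟩ -> x = x' /\ y = y'.
Proof.
intro H; unfold opair in H.
assert (Hx : x = x').
{ assert (H1 : upair x x ∈ upair (upair x' x') (upair x' y'))
    by (rewrite <- H, in_upair; auto).
  assert (Hin : x' ∈ upair x x).
  { apply in_upair in H1 as [H1 | H1]; rewrite H1, in_upair; auto. }
  now apply in_upair in Hin as [-> | ->]. }
subst x'; split; [reflexivity |].
assert (H1 : upair x y ∈ upair (upair x x) (upair x y'))
  by (rewrite <- H, in_upair; auto).
assert (H2 : upair x y' ∈ upair (upair x x) (upair x y))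
  by (rewrite H, in_upair; auto).
assert (Hy : y ∈ upair x y) by (rewrite in_upair; auto).
assert (Hy' : y' ∈ upair x y') by (rewrite in_upair; auto).
apply in_upair in H1 as [H1 | H1]; rewrite H1 in Hy; apply in_upair in Hy;
apply in_upair in H2 as [H2 | H2]; rewrite H2 in Hy'; apply in_upair in Hy';
intuition congruence.
Qed.

(** * Definable predicates and terms *)

(** These are the predicates to which comprehension applies. Hiding the formula behind an
    existential lets definability be proved by structural rules, without writing formulas down. *)
Definition Def (P : env -> Prop) : Prop :=
  exists f : fo (classes M), forall e, fo_eval e f <-> P e.

(** The language has no function symbols, so a term is definable through its graph: variable 0 holds
    the value and the arguments are shifted by one. *)
Definition DefT (t : env -> V) : Prop :=
  Def (fun e => e 0 = t (fun n => e (S n))).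

Lemma Def_equiv (P Q : env -> Prop) :
  (forall e, P e <-> Q e) -> Def P -> Def Q.
Proof. intros H [f Hf]; exists f; intro e; rewrite Hf; apply H. Qed.

Lemma Def_neg P : Def P -> Def (fun e => ~ P e).
Proof. intros [f Hf]; exists (FoNeg f); intro e; cbn; now rewrite Hf. Qed.

Lemma Def_and P Q : Def P -> Def Q -> Def (fun e => P e /\ Q e).
Proof.
intros [f Hf] [g Hg]; exists (FoAnd f g); intro e; cbn; now rewrite Hf, Hg.
Qed.

Lemma Def_or P Q : Def P -> Def Q -> Def (fun e => P e \/ Q e).
Proof.
intros HP HQ.
apply (Def_equiv (fun e => ~ (~ P e /\ ~ Q e))); [intro e; tauto |].
now apply Def_neg, Def_and; apply Def_neg.
Qed.

Lemma Def_imp (P Q : env -> Prop) : Def P -> Def Q -> Def (fun e => P e -> Q e).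
Proof.
intros HP HQ.
apply (Def_equiv (fun e => ~ P e \/ Q e)); [intro e; tauto |].
apply Def_or; [now apply Def_neg | assumption].
Qed.

Lemma Def_iff P Q : Def P -> Def Q -> Def (fun e => P e <-> Q e).
Proof. intros HP HQ; apply Def_and; now apply Def_imp. Qed.

Lemma Def_all (P : V -> env -> Prop) :
  Def (fun e => P (e 0) (fun n => e (S n))) -> Def (fun e => forall b, P b e).
Proof.
intros [f Hf]; exists (FoAll f); intro e; cbn.
split; intros H b; apply (Hf (scons b e)), H.
Qed.

Lemma Def_ex (P : V -> env -> Prop) :
  Def (fun e => P (e 0) (fun n => e (S n))) -> Def (fun e => exists b, P b e).
Proof.
intro H.
apply (Def_equiv (fun e => ~ forall b, ~ P b e)).
- intro e; split.
  + intro H'; apply NNPP; intro H1; apply H'; intros b Hb; apply H1; now exists b.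
  + intros [b Hb] H'; exact (H' b Hb).
- apply Def_neg, (Def_all (fun b e => ~ P b e)); now apply Def_neg.
Qed.

Fixpoint fo_ren (r : nat -> nat) (f : fo (classes M)) : fo (classes M) :=
  match f with
  | FoEq _ i j => FoEq _ (r i) (r j)
  | FoIn _ i j => FoIn _ (r i) (r j)
  | FoCls i X => FoCls (r i) X
  | FoNeg f => FoNeg (fo_ren r f)
  | FoAnd f g => FoAnd (fo_ren r f) (fo_ren r g)
  | FoAll f => FoAll (fo_ren (fun n => match n with 0 => 0 | S m => S (r m) end) f)
  end.

Lemma fo_eval_ren (f : fo (classes M)) : forall (r : nat -> nat) (e e' : env),
  (forall n, e' n = e (r n)) -> (fo_eval e (fo_ren r f) <-> fo_eval e' f).
Proof.
induction f as [i j | i j | i X | f IH | f IHf g IHg | f IH];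
  intros r e e' H; cbn.
- now rewrite !H.
- now rewrite !H.
- now rewrite !H.
- now rewrite (IH r e e' H).
- now rewrite (IHf r e e' H), (IHg r e e' H).
- assert (Hb : forall b n, scons b e' n =
    scons b e (match n with 0 => 0 | S m => S (r m) end))
    by (intros b [| n]; cbn; auto).
  split; intros Hf b; apply (IH _ _ _ (Hb b)), Hf.
Qed.

Lemma Def_ren (P : env -> Prop) (r : nat -> nat) :
  Def P -> Def (fun e => P (fun n => e (r n))).
Proof.
intros [f Hf]; exists (fo_ren r f); intro e.
rewrite <- Hf; now apply fo_eval_ren.
Qed.

(** Classically, a proposition independent of the environment is equivalent to a constantly true or
    constantly false formula, even if it quantifies over classes. *)
Lemma Def_const (Q : Prop) : Def (fun _ => Q).
Proof.
destruct (classic Q) as [H | H].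
- exists (FoAll (FoEq _ 0 0)); intro e; cbn; split; auto.
- exists (FoNeg (FoAll (FoEq _ 0 0))); intro e; cbn; split; [intros [] | intro]; auto.
Qed.

(** Substitution of a term is an existential quantification over its value, the graph of the term
    being definable. *)
Lemma Def_comp1 (P : V -> Prop) t :
  Def (fun e => P (e 0)) -> DefT t -> Def (fun e => P (t e)).
Proof.
intros HP Ht.
apply (Def_equiv (fun e => exists b, b = t e /\ P b)).
- intro e; split; [now intros [b [-> H]] | intro H; now exists (t e)].
- apply (Def_ex (fun b e => b = t e /\ P b)); now apply Def_and.
Qed.

Lemma Def_comp (P : V -> env -> Prop) t :
  Def (fun e => P (e 0) (fun n => e (S n))) -> DefT t ->
  Def (fun e => P (t e) e).
Proof.
intros HP Ht.
apply (Def_equiv (fun e => exists b, b = t e /\ P b e)).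
- intro e; split; [now intros [b [-> H]] | intro H; now exists (t e)].
- apply (Def_ex (fun b e => b = t e /\ P b e)); now apply Def_and.
Qed.

Lemma DefT_weaken t : DefT t -> DefT (fun e => t (fun n => e (S n))).
Proof.
intro H.
exact (Def_ren _ (fun n => match n with 0 => 0 | S m => S (S m) end) H).
Qed.

Lemma Def_comp2 (P : V -> V -> Prop) t u :
  Def (fun e => P (e 0) (e 1)) -> DefT t -> DefT u ->
  Def (fun e => P (t e) (u e)).
Proof.
intros HP Ht Hu.
apply (Def_comp (fun x e => P x (u e))); [| assumption].
apply (Def_comp (fun y e => P (e 0) y)); [| now apply DefT_weaken].
exact (Def_ren _ (fun n => match n with 0 => 1 | 1 => 0 | m => m end) HP).
Qed.

Lemma Def_comp3 (P : V -> V -> V -> Prop) t u v :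
  Def (fun e => P (e 0) (e 1) (e 2)) -> DefT t -> DefT u -> DefT v ->
  Def (fun e => P (t e) (u e) (v e)).
Proof.
intros HP Ht Hu Hv.
apply (Def_comp (fun x e => P x (u e) (v e))); [| assumption].
apply (Def_comp (fun y e => P (e 0) y (v (fun n => e (S n)))));
  [| now apply DefT_weaken].
apply (Def_comp (fun z e => P (e 1) (e 0) z));
  [| now apply (DefT_weaken (fun e => v (fun n => e (S n)))), DefT_weaken].
exact (Def_ren _ (fun n => match n with 0 => 2 | 2 => 0 | m => m end) HP).
Qed.

Lemma Def_comp4 (P : V -> V -> V -> V -> Prop) t u v w :
  Def (fun e => P (e 0) (e 1) (e 2) (e 3)) ->
  DefT t -> DefT u -> DefT v -> DefT w ->
  Def (fun e => P (t e) (u e) (v e) (w e)).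
Proof.
intros HP Ht Hu Hv Hw.
apply (Def_comp (fun x e => P x (u e) (v e) (w e))); [| assumption].
apply (Def_comp (fun y e => P (e 0) y (v (fun n => e (S n)))
  (w (fun n => e (S n))))); [| now apply DefT_weaken].
apply (Def_comp (fun z e => P (e 1) (e 0) z (w (fun n => e (S (S n))))));
  [| now apply (DefT_weaken (fun e => v (fun n => e (S n)))), DefT_weaken].
apply (Def_comp (fun z e => P (e 2) (e 1) (e 0) z));
  [| now apply (DefT_weaken (fun e => w (fun n => e (S (S n))))),
       (DefT_weaken (fun e => w (fun n => e (S n)))), DefT_weaken].
exact (Def_ren _ (fun n => match n with 0 => 3 | 1 => 2 | 2 => 1 | 3 => 0 | m => m end) HP).
Qed.

Lemma DefT_var n : DefT (fun e => e n).
Proof. exists (FoEq _ 0 (S n)); intro e; cbn; tauto. Qed.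

Lemma Def_eq t u : DefT t -> DefT u -> Def (fun e => t e = u e).
Proof.
apply (Def_comp2 (fun x y => x = y)); exists (FoEq _ 0 1); intro e; cbn; tauto.
Qed.

Lemma Def_mem t u : DefT t -> DefT u -> Def (fun e => t e ∈ u e).
Proof.
apply (Def_comp2 (fun x y => x ∈ y)); exists (FoIn _ 0 1); intro e; cbn; tauto.
Qed.

Lemma Def_cls t (X : classes M) : DefT t -> Def (fun e => t e ∈c X).
Proof.
apply (Def_comp1 (fun x => x ∈c X)); exists (FoCls 0 X); intro e; cbn; tauto.
Qed.

Lemma DefT_char (t : env -> V) (Q : V -> env -> Prop) :
  (forall e y, y = t e <-> Q y e) ->
  Def (fun e => Q (e 0) (fun n => e (S n))) -> DefT t.
Proof. intros H; apply Def_equiv; intro e; now rewrite H. Qed.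

Lemma class_of (P : V -> Prop) :
  Def (fun e => P (e 0)) -> exists X : classes M, forall x, x ∈c X <-> P x.
Proof.
intros [f Hf].
destruct (comprehension (GBC_axioms M) f (fun _ => empty M)) as [X HX].
exists X; intro x; rewrite HX; exact (Hf (scons x _)).
Qed.

(* A set parameter is traded for the class of its members, so that it does not
   occupy a variable. *)
Lemma DefT_const (c : V) : DefT (fun _ => c).
Proof.
destruct (comprehension (GBC_axioms M) (FoIn _ 0 1) (fun _ => c)) as [C HC].
apply (DefT_char (fun _ => c) (fun y e => forall z, z ∈ y <-> z ∈c C)).
- intros _ y; cbn in HC; split.
  + intros ->; intro z; now rewrite HC.
  + intro H; apply ext; intro z; now rewrite H, HC.
- apply (Def_all (fun z e => z ∈ e 0 <-> z ∈c C)).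
  apply Def_iff; [apply Def_mem | apply Def_cls]; apply DefT_var.
Qed.

Lemma DefT_comp (F : V -> V) t :
  DefT (fun e => F (e 0)) -> DefT t -> DefT (fun e => F (t e)).
Proof.
intros HF Ht.
apply (Def_comp2 (fun y x => y = F x) (fun e => e 0) (fun e => t (fun n => e (S n)))).
- exact HF.
- apply DefT_var.
- now apply DefT_weaken.
Qed.

Lemma DefT_comp2 (F : V -> V -> V) t u :
  DefT (fun e => F (e 0) (e 1)) -> DefT t -> DefT u ->
  DefT (fun e => F (t e) (u e)).
Proof.
intros HF Ht Hu.
apply (Def_comp3 (fun y x x' => y = F x x') (fun e => e 0)
  (fun e => t (fun n => e (S n))) (fun e => u (fun n => e (S n)))).
- exact HF.
- apply DefT_var.
- now apply DefT_weaken.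
- now apply DefT_weaken.
Qed.

Lemma DefT_comp3 (F : V -> V -> V -> V) t u v :
  DefT (fun e => F (e 0) (e 1) (e 2)) -> DefT t -> DefT u -> DefT v ->
  DefT (fun e => F (t e) (u e) (v e)).
Proof.
intros HF Ht Hu Hv.
apply (Def_comp4 (fun y x x' x'' => y = F x x' x'') (fun e => e 0)
  (fun e => t (fun n => e (S n))) (fun e => u (fun n => e (S n)))
  (fun e => v (fun n => e (S n)))).
- exact HF.
- apply DefT_var.
- now apply DefT_weaken.
- now apply DefT_weaken.
- now apply DefT_weaken.
Qed.
End Definability.

(* Extended with ::= whenever new terms and predicates are shown definable. *)
Ltac def_term := fail.
Ltac def_pred := fail.
Ltac def_hyp :=
  match goal with
  | H : DefT (fun e => ?F (e 0)) |- DefT (fun e => ?F (@?t e)) =>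
      apply (DefT_comp F t H)
  | H : DefT (fun e => ?F (e 0) (e 1)) |- DefT (fun e => ?F (@?t e) (@?u e)) =>
      apply (DefT_comp2 F t u H)
  | H : Def (fun e => ?P (e 0)) |- Def (fun e => ?P (@?t e)) =>
      apply (Def_comp1 P t H)
  | H : Def (fun e => ?P (e 0) (e 1)) |- Def (fun e => ?P (@?t e) (@?u e)) =>
      apply (Def_comp2 P t u H)
  end.
Ltac def_step :=
  cbv beta;
  lazymatch goal with
  | |- Def (fun e => ~ @?P e) => apply (Def_neg P)
  | |- Def (fun e => @?P e /\ @?Q e) => apply (Def_and P Q)
  | |- Def (fun e => @?P e \/ @?Q e) => apply (Def_or P Q)
  | |- Def (fun e => @?P e <-> @?Q e) => apply (Def_iff P Q)
  | |- Def (fun e => exists b, @?P b e) =>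
      apply (Def_ex (fun b e => P e b)) || apply (Def_ex (fun b e => P b e))
  | |- Def (fun e => @?t e = @?u e) => apply (Def_eq t u)
  | |- Def (fun e => @?t e ∈ @?u e) => apply (Def_mem t u)
  | |- Def (fun e => @?t e ∈c ?X) => apply (Def_cls t X)
  | |- Def (fun e => @?P e -> @?Q e) => apply (Def_imp P Q)
  | |- Def (fun e => forall b : sets _, @?P b e) =>
      apply (Def_all (fun b e => P e b)) || apply (Def_all (fun b e => P b e))
  | |- Def _ => first [ assumption | simple apply Def_const | def_hyp | def_pred ]
  | |- DefT (fun e => e ?n) => apply (DefT_var n)
  | |- DefT _ => first [ assumption | simple apply DefT_const | def_hyp | def_term ]
  end.
Ltac def := repeat def_step.

(** * Definable set terms and descriptions *)

Section SetTerms.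
Context {M : GBC_model}.
Notation V := (sets M).
Notation env := (nat -> sets M).

Lemma DefT_upair (t u : env -> V) : DefT t -> DefT u -> DefT (fun e => upair (t e) (u e)).
Proof.
apply (DefT_comp2 (fun x y => upair x y)).
apply (DefT_char _ (fun y e => forall z, z ∈ y <-> z = e 0 \/ z = e 1)).
- intros e y; rewrite <- upair_char; reflexivity.
- def.
Qed.

Lemma DefT_union (t : env -> V) : DefT t -> DefT (fun e => union (t e)).
Proof.
apply (DefT_comp (fun x => union x)).
apply (DefT_char _ (fun y e => forall z, z ∈ y <-> exists w, w ∈ e 0 /\ z ∈ w)).
- intros e y; split.
  + intros -> z; apply in_union.
  + intro H; apply ext; intro z; now rewrite H, in_union.
- def.
Qed.
End SetTerms.

Ltac def_term ::=
  first
  [ simple apply DefT_upair | simple apply DefT_union ].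

Section Sets.
Context {M : GBC_model}.
Notation V := (sets M).
Notation env := (nat -> sets M).

Lemma DefT_opair (t u : env -> V) :
  DefT t -> DefT u -> DefT (fun e => ⟨t e, u e⟩).
Proof. intros; unfold opair; def. Qed.

Lemma DefT_adjoin (t u : env -> V) :
  DefT t -> DefT u -> DefT (fun e => adjoin (t e) (u e)).
Proof. intros; unfold adjoin; def. Qed.

Definition unique_in (P : V -> Prop) : Prop :=
  (exists y, P y) /\ forall y y', P y -> P y' -> y = y'.

(* Junk value: the empty set, when [P] does not have exactly one element. *)
Definition iota (P : V -> Prop) : V :=
  epsilon (inhabits (empty M))
    (fun y => unique_in P /\ P y \/ ~ unique_in P /\ y = empty M).

Lemma iota_char (P : V -> Prop) y :
  y = iota P <-> unique_in P /\ P y \/ ~ unique_in P /\ y = empty M.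
Proof.
assert (H : unique_in P /\ P (iota P) \/ ~ unique_in P /\ iota P = empty M).
{ apply (epsilon_spec (inhabits (empty M))
    (fun y => unique_in P /\ P y \/ ~ unique_in P /\ y = empty M)).
  destruct (classic (unique_in P)) as [HP | HP].
  - destruct (proj1 HP) as [z Hz]; exists z; auto.
  - exists (empty M); auto. }
split; [intros ->; exact H |].
intros [[HP Hy] | [HP ->]]; destruct H as [[HP' H] | [HP' H]]; try tauto.
- now apply HP.
- congruence.
Qed.

Lemma iota_spec (P : V -> Prop) : unique_in P -> P (iota P).
Proof.
intro HP; destruct (proj1 (iota_char P (iota P)) eq_refl) as [[_ H] | [H _]];
  [exact H | contradiction].
Qed.

Lemma iota_eq (P : V -> Prop) y :
  P y -> (forall y y', P y -> P y' -> y = y') -> iota P = y.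
Proof.
intros Hy HP; symmetry; apply iota_char; left; split; [split |]; eauto.
Qed.

Lemma DefT_iota (P : V -> env -> Prop) :
  Def (fun e => P (e 0) (fun n => e (S n))) ->
  DefT (fun e => iota (fun y => P y e)).
Proof.
intro HP.
(* The shifted copies are the forms in which [def] meets [P] under the quantifiers of the
   characterization below. *)
assert (HP1 : Def (fun e => P (e 0) (fun n => e (S (S n)))))
  by exact (Def_ren _ (fun n => match n with 0 => 0 | S m => S (S m) end) HP).
assert (HP2 : Def (fun e => P (e 0) (fun n => e (S (S (S n))))))
  by exact (Def_ren _ (fun n => match n with 0 => 0 | S m => S (S (S m)) end) HP).
assert (HP3 : Def (fun e => P (e 1) (fun n => e (S (S (S n))))))
  by exact (Def_ren _ (fun n => match n with 0 => 1 | S m => S (S (S m)) end) HP).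
apply (DefT_char _ (fun y e =>
  ((exists z, P z e) /\ forall z z', P z e -> P z' e -> z = z') /\ P y e \/
  ~ ((exists z, P z e) /\ forall z z', P z e -> P z' e -> z = z') /\
    y = empty M)).
- intros e y; exact (iota_char (fun y => P y e) y).
- def.
Qed.

Definition setof (P : V -> Prop) : V := iota (fun y => forall z, z ∈ y <-> P z).

Lemma in_setof (P : V -> Prop) :
  (exists y, forall z, z ∈ y <-> P z) -> forall z, z ∈ setof P <-> P z.
Proof.
intro H; unfold setof; apply (iota_spec (fun y => forall z, z ∈ y <-> P z)).
split; [exact H |].
intros y y' Hy Hy'; apply ext; intro z; now rewrite Hy, Hy'.
Qed.

Lemma DefT_setof (P : V -> env -> Prop) :
  Def (fun e => P (e 0) (fun n => e (S n))) ->
  DefT (fun e => setof (fun z => P z e)).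
Proof.
intro HP; unfold setof.
apply (DefT_iota (fun y e => forall z, z ∈ y <-> P z e)).
def.
exact (Def_ren _ (fun n => match n with 0 => 0 | S m => S (S m) end) HP).
Qed.
End Sets.

Ltac def_term ::=
  first
  [ simple apply DefT_upair | simple apply DefT_union | simple apply DefT_opair
  | simple apply DefT_adjoin
  | lazymatch goal with
    | |- DefT (fun e => iota (fun y => @?P e y)) =>
        apply (DefT_iota (fun y e => P e y))
    | |- DefT (fun e => setof (fun y => @?P e y)) =>
        apply (DefT_setof (fun y e => P e y))
    end ].

(** * Induction and replacement for definable predicates *)

Section Foundation.
Context {M : GBC_model}.
Notation V := (sets M).
Notation env := (nat -> sets M).

(** Regularity yields an ∈-minimal counterexample; definability of [P] is what makes the
    counterexamples a class. *)
Lemma in_ind (P : V -> Prop) : Def (fun e => P (e 0)) ->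
  (forall x, (forall y, y ∈ x -> P y) -> P x) -> forall x, P x.
Proof.
intros HP H x.
destruct (class_of (fun x => ~ P x)) as [X HX]; [def |].
apply NNPP; intro Hx.
destruct (class_regularity (GBC_axioms M) (X := X)) as [m [Hm Hmin]].
- exists x; now apply HX.
- apply HX in Hm; apply Hm, H; intros y Hy.
  apply NNPP; intro Hy'; apply (Hmin y Hy), HX, Hy'.
Qed.

Lemma replacement (R : V -> V -> Prop) (a : V) :
  Def (fun e => R (e 0) (e 1)) ->
  (forall x y y', x ∈ a -> R x y -> R x y' -> y = y') ->
  exists b, forall y, y ∈ b <-> exists x, x ∈ a /\ R x y.
Proof.
intros HR Hf.
(* The axiom asks for a class functional everywhere, whereas [R] is functional only on [a]; hence
   the restriction to [a]. *)
destruct (class_of (fun p => exists x y, p = ⟨x, y⟩ /\ x ∈ a /\ R x y))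
  as [F HF].
def.
assert (HF' : forall x y, class_rel F x y <-> x ∈ a /\ R x y).
{ intros x y; unfold class_rel; split.
  - intros [p [Hp HpF]]; apply opair_char in Hp; subst p.
    apply HF in HpF as (x' & y' & E & H); apply opair_inj in E as [-> ->].
    exact H.
  - intro H; exists ⟨x, y⟩; rewrite opair_char, HF; eauto. }
destruct (class_replacement (GBC_axioms M) (F := F) a) as [b Hb].
- intros x y y' H H'; apply HF' in H, H'; eapply Hf; intuition eauto.
- exists b; intro y; rewrite Hb; split; intros [x Hx]; exists x;
    rewrite HF' in *; tauto.
Qed.

Lemma separation (P : V -> Prop) (a : V) : Def (fun e => P (e 0)) ->
  exists b, forall y, y ∈ b <-> y ∈ a /\ P y.
Proof.
intro HP.
destruct (replacement (fun x y => x = y /\ P x) a) as [b Hb].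
- def.
- intros x y y' _ [-> _] [-> _]; reflexivity.
- exists b; intro y; rewrite Hb; split.
  + intros [x [Hx [-> H]]]; auto.
  + intros [Hy H]; eauto.
Qed.

Lemma image (F : V -> V) (P : V -> Prop) (a : V) :
  DefT (fun e => F (e 0)) -> Def (fun e => P (e 0)) ->
  exists b, forall y, y ∈ b <-> exists x, x ∈ a /\ P x /\ y = F x.
Proof.
intros HF HP; apply (replacement (fun x y => P x /\ y = F x)).
- def.
- intros x y y' _ [_ ->] [_ ->]; reflexivity.
Qed.

Lemma in_irrefl (x : V) : ~ x ∈ x.
Proof.
revert x; apply (in_ind (fun x => ~ x ∈ x)); [def |].
intros x H Hx; exact (H x Hx Hx).
Qed.

Lemma in_asym (x y : V) : x ∈ y -> ~ y ∈ x.
Proof.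
revert x y; apply (in_ind (fun x => forall y, x ∈ y -> ~ y ∈ x)); [def |].
intros x H y Hxy Hyx; exact (H y Hyx x Hyx Hxy).
Qed.

Lemma in_acyclic3 (x y z : V) : x ∈ y -> y ∈ z -> ~ z ∈ x.
Proof.
revert x y z.
apply (in_ind (fun x => forall y z, x ∈ y -> y ∈ z -> ~ z ∈ x)); [def |].
intros x H y z Hxy Hyz Hzx; exact (H z Hzx x y Hzx Hxy Hyz).
Qed.

(** Linearity of β compares z with α, and the two unwanted cases are ∈-cycles of length two and
    three. *)
Lemma ordinal_in (α β : V) : is_ordinal β -> α ∈ β -> is_ordinal α.
Proof.
intros [Ht Hl] Ha; split.
- intros y z Hz Hy.
  assert (Hyb : y ∈ β) by exact (Ht α y Hy Ha).
  assert (Hzb : z ∈ β) by exact (Ht y z Hz Hyb).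
  destruct (Hl z α Hzb Ha) as [H | [-> | H]]; [exact H | |].
  + destruct (in_asym _ _ Hy Hz).
  + destruct (in_acyclic3 _ _ _ H Hz Hy).
- intros y z Hy Hz; apply Hl; eapply Ht; eassumption.
Qed.

(** * Transitive closure and recursion *)

Definition transitive (x : V) : Prop := forall y z, z ∈ y -> y ∈ x -> z ∈ x.

Definition is_tc (x t : V) : Prop :=
  transitive t /\ subset x t /\
  forall t', transitive t' -> subset x t' -> subset t t'.

(** The closure does not contain x itself, so [y ∈ tc x] is a strict relation along which induction
    and recursion are possible. *)
Definition tc (x : V) : V := iota (is_tc x).

Lemma Def_transitive (t : env -> V) : DefT t -> Def (fun e => transitive (t e)).
Proof.
apply (Def_comp1 (fun x => transitive x)); unfold transitive; def.
Qed.

Lemma Def_subset (t u : env -> V) :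
  DefT t -> DefT u -> Def (fun e => subset (t e) (u e)).
Proof.
apply (Def_comp2 (fun x y => subset x y)); unfold subset; def.
Qed.

Ltac def_pred ::= first [ simple apply Def_transitive | simple apply Def_subset ].

Lemma DefT_tc (t : env -> V) : DefT t -> DefT (fun e => tc (t e)).
Proof.
apply (DefT_comp (fun x => tc x)); unfold tc, is_tc; def.
Qed.

Lemma tc_unique x t t' : is_tc x t -> is_tc x t' -> t = t'.
Proof.
intros (Ht & Hs & Hl) (Ht' & Hs' & Hl'); apply ext; intro z; split.
- now apply Hl.
- now apply Hl'.
Qed.

(** By ∈-induction, x together with the closures of its members is a set that bounds the closure;
    separating from it the elements common to all transitive supersets of x gives the least one. *)
Lemma tc_spec x : is_tc x (tc x).
Proof.
revert x; apply (in_ind (fun x => is_tc x (tc x))).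
{ unfold is_tc; def; simple apply DefT_tc; def. }
intros x IH; apply (iota_spec (is_tc x)); split; [| apply tc_unique].
assert (Htc := DefT_tc).
destruct (image tc (fun _ => True) x) as [T HT]; [now apply Htc; def | def |].
assert (Hu : forall z, z ∈ union (upair x (union T)) <->
  z ∈ x \/ exists y, y ∈ x /\ z ∈ tc y).
{ intro z; rewrite in_union; split.
  - intros [y [Hy Hz]]; apply in_upair in Hy as [-> | ->]; [now left | right].
    apply in_union in Hz as [w [Hw Hz]].
    apply HT in Hw as (y & Hy & _ & ->); eauto.
  - intros [H | (y & Hy & Hz)].
    + exists x; rewrite in_upair; auto.
    + exists (union T); rewrite in_upair, in_union; split; [auto |].
      exists (tc y); rewrite HT; eauto. }
destruct (separation (fun z => forall t', transitive t' -> subset x t' -> z ∈ t')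
  (union (upair x (union T)))) as [t Ht]; [def |].
assert (Hall : forall t', transitive t' -> subset x t' ->
  forall y, y ∈ x -> subset (tc y) t').
{ intros t' Ht' Hx y Hy; destruct (IH y Hy) as (_ & _ & Hl).
  apply Hl; [assumption |]; intros z Hz; exact (Ht' y z Hz (Hx y Hy)). }
exists t; split; [| split].
- intros y z Hz Hy; apply Ht in Hy as [Hy Hy']; apply Ht; split.
  + apply Hu; right; apply Hu in Hy as [Hy | (w & Hw & Hy)].
    * exists y; split; [assumption |]; exact (proj1 (proj2 (IH y Hy)) z Hz).
    * exists w; split; [assumption |].
      exact (proj1 (IH w Hw) y z Hz Hy).
  + intros t' Ht' Hx; exact (Ht' y z Hz (Hy' t' Ht' Hx)).
- intros z Hz; apply Ht; split; [apply Hu; auto | intros t' _ H; auto].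
- intros t' Ht' Hx z Hz; apply Ht in Hz as [_ Hz]; auto.
Qed.

Lemma tc_transitive x : transitive (tc x).
Proof. apply tc_spec. Qed.

Lemma in_tc x y : y ∈ x -> y ∈ tc x.
Proof. apply (tc_spec x). Qed.

Lemma tc_least x t : transitive t -> subset x t -> subset (tc x) t.
Proof. apply (tc_spec x). Qed.

Lemma tc_mono x y : y ∈ tc x -> subset (tc y) (tc x).
Proof.
intro H; apply tc_least; [apply tc_transitive |].
intros z Hz; exact (tc_transitive x y z Hz H).
Qed.

(** ∈-induction on the statement that [P] holds throughout [tc x]: the z in [tc x] such that [P]
    holds at z and on [tc z] form a transitive superset of x, hence exhaust [tc x]. *)
Lemma tc_ind (P : V -> Prop) : Def (fun e => P (e 0)) ->
  (forall x, (forall y, y ∈ tc x -> P y) -> P x) -> forall x, P x.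
Proof.
intros HP H.
assert (HQ : forall x y, y ∈ tc x -> P y); [| eauto].
assert (Htc := DefT_tc).
apply (in_ind (fun x => forall y, y ∈ tc x -> P y)).
- def; now apply Htc; def.
- intros x IH.
  destruct (separation (fun z => P z /\ forall w, w ∈ tc z -> P w) (tc x))
    as [s Hs].
  { def; now apply Htc; def. }
  assert (Hts : subset (tc x) s).
  { apply tc_least.
    - intros y z Hz Hy; apply Hs in Hy as (Hy & Hy1 & Hy2); apply Hs.
      assert (Hzy : z ∈ tc y) by now apply in_tc.
      repeat split.
      + exact (tc_transitive x y z Hz Hy).
      + now apply Hy2.
      + intros w Hw; apply Hy2; exact (tc_mono y z Hzy w Hw).
    - intros y Hy; apply Hs; repeat split; [now apply in_tc | |].
      + apply H; exact (IH y Hy).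
      + exact (IH y Hy). }
  intros y Hy; now apply Hs, Hts.
Qed.
End Foundation.

Ltac def_pred ::= first [ simple apply Def_transitive | simple apply Def_subset ].
Ltac def_term ::=
  first
  [ simple apply DefT_upair | simple apply DefT_union | simple apply DefT_opair
  | simple apply DefT_adjoin | simple apply DefT_tc
  | lazymatch goal with
    | |- DefT (fun e => iota (fun y => @?P e y)) =>
        apply (DefT_iota (fun y e => P e y))
    | |- DefT (fun e => setof (fun y => @?P e y)) =>
        apply (DefT_setof (fun y e => P e y))
    end ].

(** * Recursion along transitive closures *)

Section Recursion.
Context {M : GBC_model}.
Notation V := (sets M).
Notation env := (nat -> sets M).
(** The arguments of [G] are a fixed parameter, the current argument x, and the graph of the
    function already constructed on [tc x]. *)
Context (G : V -> V -> V -> V).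
Hypothesis DefT_G : forall t u v : env -> V,
  DefT t -> DefT u -> DefT v -> DefT (fun e => G (t e) (u e) (v e)).

Definition restr (f s : V) : V :=
  setof (fun q => q ∈ f /\ exists y v, q = ⟨y, v⟩ /\ y ∈ s).

Lemma in_restr f s q :
  q ∈ restr f s <-> q ∈ f /\ exists y v, q = ⟨y, v⟩ /\ y ∈ s.
Proof. unfold restr; rewrite in_setof; [reflexivity |]; apply separation; def. Qed.

Definition is_attempt (p x f : V) : Prop :=
  forall q, q ∈ f <-> exists y, y ∈ tc x /\ q = ⟨y, G p y (restr f (tc y))⟩.

(* The graph of the recursively defined function below [x]. *)
Definition history (p x : V) : V := iota (fun f => is_attempt p x f).

Definition recur (p x : V) : V := G p x (history p x).

Lemma DefT_restr (t u : env -> V) :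
  DefT t -> DefT u -> DefT (fun e => restr (t e) (u e)).
Proof. apply (DefT_comp2 (fun f s => restr f s)); unfold restr; def. Qed.

Lemma Def_is_attempt : Def (fun e => is_attempt (e 0) (e 1) (e 2)).
Proof.
unfold is_attempt; def; apply DefT_G; def; apply DefT_restr; def.
Qed.

Lemma attempt_restr p x f y : is_attempt p x f -> y ∈ tc x ->
  is_attempt p y (restr f (tc y)).
Proof.
intros Hf Hy q; rewrite in_restr, (Hf q).
assert (Hr : forall z, z ∈ tc y -> restr (restr f (tc y)) (tc z) = restr f (tc z)).
{ intros z Hz; apply ext; intro r; rewrite !in_restr; split.
  - intros [[H _] H']; auto.
  - intros [H (w & v & -> & Hw)]; repeat split; eauto.
    exists w, v; split; [reflexivity | exact (tc_mono y z Hz w Hw)]. }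
split.
- intros [(z & Hz & ->) (w & v & E & Hw)]; apply opair_inj in E as [<- _].
  exists z; now rewrite Hr.
- intros (z & Hz & ->); rewrite Hr by assumption; split; [| eauto].
  exists z; split; [exact (tc_mono x y Hy z Hz) | reflexivity].
Qed.

(** By induction the two attempts agree after restriction to [tc y], for each y in [tc x]; the
    recursion equation then gives them the same value at y. *)
Lemma attempt_unique p x f f' : is_attempt p x f -> is_attempt p x f' -> f = f'.
Proof.
revert x f f'.
apply (tc_ind (fun x => forall f f',
  is_attempt p x f -> is_attempt p x f' -> f = f')).
{ def; apply (Def_comp3 _ _ _ _ Def_is_attempt); def. }
intros x IH f f' Hf Hf'; apply ext; intro q; rewrite (Hf q), (Hf' q).
split; intros (y & Hy & ->); exists y; split; trivial;
  do 2 f_equal; eauto using attempt_restr.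
Qed.

Lemma DefT_history (t u : env -> V) :
  DefT t -> DefT u -> DefT (fun e => history (t e) (u e)).
Proof.
apply (DefT_comp2 (fun p x => history p x)); unfold history; def.
apply (Def_comp3 _ _ _ _ Def_is_attempt); def.
Qed.

Lemma DefT_recur (t u : env -> V) :
  DefT t -> DefT u -> DefT (fun e => recur (t e) (u e)).
Proof. intros; unfold recur; apply DefT_G; def; now apply DefT_history. Qed.

(** Replacement collects the graph of [recur p] on [tc x]. It is an attempt because its restriction
    to [tc y] is [history p y], by the induction hypothesis and uniqueness. *)
Lemma history_spec p x : is_attempt p x (history p x).
Proof.
revert x; apply (tc_ind (fun x => is_attempt p x (history p x))).
{ apply (Def_comp3 _ _ _ _ Def_is_attempt); def; apply DefT_history; def. }
intros x IH; apply (iota_spec (is_attempt p x)).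
split; [| exact (attempt_unique p x)].
destruct (image (fun y => ⟨y, recur p y⟩) (fun _ => True) (tc x)) as [f Hf];
  [def; apply DefT_recur; def | def |].
exists f; intro q; rewrite (Hf q).
assert (Hr : forall y, y ∈ tc x -> restr f (tc y) = history p y).
{ intros y Hy; apply ext; intro r; rewrite in_restr, (Hf r), (IH y Hy r).
  assert (Hh : forall z, z ∈ tc y -> restr (history p y) (tc z) = history p z).
  { intros z Hz; apply (attempt_unique p z).
    - exact (attempt_restr p y _ z (IH y Hy) Hz).
    - exact (IH z (tc_mono x y Hy z Hz)). }
  split.
  - intros [(z & _ & _ & ->) (w & v & E & Hw)]; apply opair_inj in E as [<- _].
    exists z; now rewrite Hh.
  - intros (z & Hz & ->); rewrite Hh by assumption.
    split; [exists z | exists z, (recur p z)]; auto.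
    exact (conj (tc_mono x y Hy z Hz) (conj I eq_refl)). }
split.
- intros (y & Hy & _ & ->); exists y; now rewrite Hr.
- intros (y & Hy & ->); exists y; now rewrite Hr.
Qed.

Lemma in_history p x q :
  q ∈ history p x <-> exists y, y ∈ tc x /\ q = ⟨y, recur p y⟩.
Proof.
rewrite (history_spec p x q); split; intros (y & Hy & ->); exists y;
  (split; [assumption |]); unfold recur; do 2 f_equal;
  [| symmetry]; apply (attempt_unique p y);
  eauto using attempt_restr, history_spec.
Qed.

Lemma history_pair p x y v :
  ⟨y, v⟩ ∈ history p x <-> y ∈ tc x /\ v = recur p y.
Proof.
rewrite in_history; split.
- intros (z & Hz & E); apply opair_inj in E as [-> ->]; auto.
- intros [Hy ->]; eauto.
Qed.
End Recursion.

Ltac def_pred ::=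
  first
  [ simple apply Def_transitive | simple apply Def_subset
  | progress unfold is_natural, is_inductive, is_empty, is_succ, is_ordinal,
      is_function ].
Ltac def_term ::=
  first
  [ simple apply DefT_upair | simple apply DefT_union | simple apply DefT_opair
  | simple apply DefT_adjoin | simple apply DefT_tc
  | progress unfold cEq, cIn, cA, cNeg, cAll, cConj, cAnd, cTr
  | lazymatch goal with
    | |- DefT (fun e => iota (fun y => @?P e y)) =>
        apply (DefT_iota (fun y e => P e y))
    | |- DefT (fun e => setof (fun y => @?P e y)) =>
        apply (DefT_setof (fun y e => P e y))
    end ].

(** * The natural numbers of the model *)

Section Naturals.
Context {M : GBC_model}.
Notation V := (sets M).
Notation env := (nat -> sets M).

(** The members of a standard numeral are standard even when the omega of the model is not.
    Statements about the eight variables thus reduce to arithmetic in [nat]. *)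
Lemma in_numeral k (z : V) :
  z ∈ numeral M k <-> exists i, i < k /\ z = numeral M i.
Proof.
induction k as [| k IH]; cbn.
- split; [intro H; destruct (in_empty _ H) | intros [i [H _]]; lia].
- rewrite in_adjoin, IH; split.
  + intros [(i & Hi & ->) | ->]; [exists i | exists k]; auto with arith.
  + intros (i & Hi & ->); destruct (Nat.eq_dec i k) as [-> | Hn]; [now right |].
    left; exists i; split; [lia | reflexivity].
Qed.

Lemma numeral_inj i j : numeral M i = numeral M j -> i = j.
Proof.
intro E; destruct (Nat.lt_total i j) as [H | [H | H]]; [| assumption |].
- destruct (in_irrefl (numeral M j)); rewrite <- E at 1; apply in_numeral; eauto.
- destruct (in_irrefl (numeral M i)); rewrite E at 1; apply in_numeral; eauto.
Qed.

Lemma is_succ_adjoin (x : V) : is_succ (adjoin x x) x.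
Proof. intro z; apply in_adjoin. Qed.

Lemma natural_empty : is_natural (empty M).
Proof.
intros w [[e [He Hw]] _].
replace (empty M) with e; [assumption |].
apply ext; intro z; split; intro H; [destruct (He z H) | destruct (in_empty _ H)].
Qed.

Lemma natural_succ (n : V) : is_natural n -> is_natural (adjoin n n).
Proof.
intros Hn w Hw; destruct (proj2 Hw n (Hn w Hw)) as [s [Hs Hsw]].
replace (adjoin n n) with s; [assumption |].
apply ext; intro z; rewrite (Hs z), in_adjoin; reflexivity.
Qed.

Lemma natural_numeral k : is_natural (numeral M k).
Proof. induction k; [apply natural_empty | now apply natural_succ]. Qed.

Definition omega : V := setof (fun n => is_natural n).

Lemma in_omega n : n ∈ omega <-> is_natural n.
Proof.
unfold omega; rewrite in_setof; [reflexivity |].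
destruct (infinity (GBC_axioms M)) as [w Hw].
destruct (separation (fun n => is_natural n) w) as [o Ho]; [def |].
exists o; intro z; rewrite Ho; split; [tauto |].
intro H; split; [exact (H w Hw) | exact H].
Qed.

Lemma natural_ind (P : V -> Prop) : Def (fun e => P (e 0)) ->
  P (empty M) -> (forall n, is_natural n -> P n -> P (adjoin n n)) ->
  forall n, is_natural n -> P n.
Proof.
intros HP H0 HS n Hn.
destruct (separation P omega) as [w Hw]; [def |].
apply Hw, Hn; split.
- exists (empty M); split; [exact in_empty |].
  apply Hw; split; [apply in_omega, natural_empty | exact H0].
- intros x Hx; apply Hw in Hx as [Hx HPx]; apply in_omega in Hx.
  exists (adjoin x x); split; [apply is_succ_adjoin |].
  apply Hw; split; [now apply in_omega, natural_succ | now apply HS].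
Qed.

Lemma natural_transitive (n : V) : is_natural n -> transitive n.
Proof.
revert n; apply natural_ind; [def | |].
- intros y z _ Hy; destruct (in_empty _ Hy).
- intros n _ IH y z Hz Hy; apply in_adjoin; left.
  apply in_adjoin in Hy as [Hy | ->]; [exact (IH y z Hz Hy) | exact Hz].
Qed.

(** * The hereditarily finite sets *)

Definition level_step (p x f : V) : V :=
  setof (fun z => exists y v, y ∈ x /\ ⟨y, v⟩ ∈ f /\ subset z v).

Lemma DefT_level_step (t u v : env -> V) : DefT t -> DefT u -> DefT v ->
  DefT (fun e => level_step (t e) (u e) (v e)).
Proof.
intros _; apply (DefT_comp2 (fun x f => level_step (empty M) x f)).
unfold level_step; def.
Qed.

(* The cumulative hierarchy: level x is the union of the power sets of level y
   for y in x. *)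
Definition level (x : V) : V := recur level_step (empty M) x.

Lemma DefT_level (t : env -> V) : DefT t -> DefT (fun e => level (t e)).
Proof. intro; apply (DefT_recur _ DefT_level_step); def. Qed.

Lemma powerset_unique (x p p' : V) :
  (forall z, z ∈ p <-> subset z x) -> (forall z, z ∈ p' <-> subset z x) -> p = p'.
Proof. intros H H'; apply ext; intro z; now rewrite H, H'. Qed.

Lemma in_level (x z : V) : z ∈ level x <-> exists y, y ∈ x /\ subset z (level y).
Proof.
unfold level at 1, recur, level_step at 1; rewrite in_setof.
- split.
  + intros (y & v & Hy & Hv & Hz).
    apply (history_pair _ DefT_level_step) in Hv as [_ ->]; eauto.
  + intros (y & Hy & Hz); exists y, (level y); repeat split; auto.
    apply (history_pair _ DefT_level_step); split; [now apply in_tc | reflexivity].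
(* The collection is a set: replacement gathers the power sets of the earlier levels, and their
   union is taken. *)
- destruct (replacement (fun y p => forall z, z ∈ p <-> subset z (level y)) x)
    as [T HT].
  + def; apply DefT_level; def.
  + intros y p p' _; apply powerset_unique.
  + exists (union T); intro w; rewrite in_union; split.
    * intros (p & Hp & Hw); apply HT in Hp as (y & Hy & Hp).
      exists y, (level y); repeat split; [assumption | | now apply Hp].
      apply (history_pair _ DefT_level_step); split;
        [now apply in_tc | reflexivity].
    * intros (y & v & Hy & Hv & Hw).
      apply (history_pair _ DefT_level_step) in Hv as [_ ->].
      destruct (power_set (GBC_axioms M) (level y)) as [p Hp].
      exists p; split; [| now apply Hp].
      apply HT; exists y; split; [assumption | exact Hp].
Qed.

(** V_ω in the sense of the model: a set that contains every code of a first-order formula,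
    including those of nonstandard length. *)
Definition HF : V := level omega.

Lemma in_HF z : z ∈ HF <-> exists n, is_natural n /\ subset z (level n).
Proof.
unfold HF; rewrite in_level.
split; intros (n & Hn & Hz); exists n; split; auto; now apply in_omega.
Qed.

Lemma level_succ n : subset (level n) (level (adjoin n n)).
Proof.
intros z Hz; apply in_level in Hz as (y & Hy & Hz); apply in_level.
exists y; rewrite in_adjoin; auto.
Qed.

(** Pairing in [HF] needs a common level for two sets. Induction on n supplies one without comparing
    natural numbers: if k serves for n, its successor serves for the successor of n. *)
Lemma level_directed m n : is_natural m -> is_natural n ->
  exists k, is_natural k /\ subset (level m) (level k) /\
    subset (level n) (level k).
Proof.
intros Hm Hn; revert n Hn m Hm.
apply (natural_ind (fun n => forall m, is_natural m -> exists k, is_natural k /\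
  subset (level m) (level k) /\ subset (level n) (level k))).
- def; apply DefT_level; def.
- intros m Hm; exists m; repeat split; auto; [intros z; auto |].
  intros z Hz; apply in_level in Hz as (y & Hy & _); destruct (in_empty _ Hy).
- intros n Hn IH m Hm; destruct (IH m Hm) as (k & Hk & Hmk & Hnk).
  exists (adjoin k k); repeat split; [now apply natural_succ | |].
  + intros z Hz; now apply level_succ, Hmk.
  + intros z Hz; apply in_level in Hz as (y & Hy & Hz); apply in_level.
    exists k; rewrite in_adjoin; split; [now right |].
    intros w Hw; apply Hnk; specialize (Hz w Hw).
    apply in_adjoin in Hy as [Hy | ->]; [| assumption].
    apply in_level in Hz as (u & Hu & Hz); apply in_level.
    exists u; split; [exact (natural_transitive n Hn y u Hu Hy) | assumption].
Qed.

Lemma HF_level z : z ∈ HF -> exists n, is_natural n /\ z ∈ level n.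
Proof.
intro H; apply in_HF in H as (n & Hn & Hz); exists (adjoin n n).
split; [now apply natural_succ |].
apply in_level; exists n; rewrite in_adjoin; auto.
Qed.

Lemma HF_upair x y : x ∈ HF -> y ∈ HF -> upair x y ∈ HF.
Proof.
intros Hx Hy; apply HF_level in Hx as (m & Hm & Hx), Hy as (n & Hn & Hy).
destruct (level_directed m n Hm Hn) as (k & Hk & Hmk & Hnk).
apply in_HF; exists k; split; [assumption |].
intros z Hz; apply in_upair in Hz as [-> | ->]; auto.
Qed.

Lemma HF_opair x y : x ∈ HF -> y ∈ HF -> ⟨x, y⟩ ∈ HF.
Proof. intros; unfold opair; auto using HF_upair. Qed.

Lemma HF_natural n : is_natural n -> n ∈ HF.
Proof.
revert n; apply natural_ind; [def | |].
- apply in_HF; exists (empty M); split; [apply natural_empty |].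
  intros z Hz; destruct (in_empty _ Hz).
- intros n Hn IH; apply in_HF in IH as (k & Hk & Hnk).
  apply in_HF; exists (adjoin k k); split; [now apply natural_succ |].
  intros z Hz; apply in_adjoin in Hz as [Hz | ->].
  + apply level_succ; auto.
  + apply in_level; exists k; rewrite in_adjoin; auto.
Qed.

Lemma HF_numeral k : numeral M k ∈ HF.
Proof. apply HF_natural, natural_numeral. Qed.
End Naturals.

Ltac inv_codes :=
  unfold cEq, cIn, cA, cNeg, cAll, cConj, cAnd, cTr in *;
  repeat match goal with
  | H : ⟨_, _⟩ = ⟨_, _⟩ |- _ => apply opair_inj in H as [? ?]
  | H : numeral _ _ = numeral _ _ |- _ => apply numeral_inj in H; try discriminate H
  end; subst.

Ltac hf :=
  unfold cEq, cIn, cA, cNeg, cAnd, cAll, cTr;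
  repeat apply HF_opair; first [apply HF_numeral | now apply HF_natural | assumption].

Ltac split_closed := hnf; repeat match goal with |- _ /\ _ => split end.

(** * The set of first-order formulas *)

Section Formulas.
Context {M : GBC_model}.
Notation V := (sets M).
Notation env := (nat -> sets M).

Definition fin_set_closed (s : V) : Prop :=
  (forall x y, is_natural x -> is_natural y -> cEq x y ∈ s) /\
  (forall x y, is_natural x -> is_natural y -> cIn x y ∈ s) /\
  (forall x, is_natural x -> cA x ∈ s) /\
  (forall x y z, is_natural x -> is_natural y -> is_natural z ->
     cTr x y z ∈ s) /\
  (forall φ, φ ∈ s -> cNeg φ ∈ s) /\
  (forall φ ψ, φ ∈ s -> ψ ∈ s -> cAnd φ ψ ∈ s) /\
  (forall x φ, is_natural x -> φ ∈ s -> cAll x φ ∈ s).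

(** A substitute for [fin_formula] that quantifies over closed sets instead of closed classes and
    may therefore occur in comprehension. *)
Definition fin_formulas : V :=
  setof (fun φ => φ ∈ HF /\ forall s, fin_set_closed s -> φ ∈ s).

(** [HF] is closed under the formula constructors, so a closed class meets it in a closed set.
    Conversely, the right side of the definition of [fin_formulas] determines a closed class. *)
Lemma in_fin_formulas φ : φ ∈ fin_formulas <-> fin_formula φ.
Proof.
assert (HD : Def (fun e : env => e 0 ∈ HF /\
  forall s, fin_set_closed s -> e 0 ∈ s)) by (unfold fin_set_closed; def).
unfold fin_formulas; rewrite in_setof.
- split.
  + intros [Hφ H] X HX.
    destruct (separation (fun φ => φ ∈c X) HF) as [s Hs]; [def |].
    apply Hs, H.
    destruct HX as (H1 & H2 & H3 & H4 & H5 & H6 & H7).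
    split_closed; intros; apply Hs;
      repeat match goal with H : _ ∈ s |- _ => apply Hs in H as [? ?] end;
      (split; [hf |]);
      [apply H1 | apply H2 | apply H3 | apply H4 | apply H5 | apply H6 | apply H7];
      assumption.
  + intro H;
    destruct (class_of (fun φ => φ ∈ HF /\ forall s, fin_set_closed s -> φ ∈ s)
      HD) as [X HX]; apply HX, H; clear HD φ H.
    split_closed; intros;
      repeat match goal with H : _ ∈c X |- _ => apply HX in H as [? ?] end;
      apply HX; (split; [hf |]); intros s Hs;
      repeat match goal with
      | H : forall s, fin_set_closed s -> _ |- _ => specialize (H s Hs)
      end; destruct Hs as (C1 & C2 & C3 & C4 & C5 & C6 & C7);
      [apply C1 | apply C2 | apply C3 | apply C4 | apply C5 | apply C6 | apply C7];
      assumption.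
- apply separation; unfold fin_set_closed; def.
Qed.

Lemma fin_ind (P : V -> Prop) : Def (fun e => P (e 0)) ->
  (forall x y, is_natural x -> is_natural y -> P (cEq x y)) ->
  (forall x y, is_natural x -> is_natural y -> P (cIn x y)) ->
  (forall x, is_natural x -> P (cA x)) ->
  (forall x y z, is_natural x -> is_natural y -> is_natural z -> P (cTr x y z)) ->
  (forall φ, fin_formula φ -> P φ -> P (cNeg φ)) ->
  (forall φ ψ, fin_formula φ -> fin_formula ψ -> P φ -> P ψ -> P (cAnd φ ψ)) ->
  (forall x φ, is_natural x -> fin_formula φ -> P φ -> P (cAll x φ)) ->
  forall φ, fin_formula φ -> P φ.
Proof.
intros HP H1 H2 H3 H4 H5 H6 H7 φ Hφ.
destruct (class_of (fun φ => φ ∈ fin_formulas /\ P φ)) as [X HX]; [def |].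
enough (H : fin_closed X) by now apply HX, Hφ.
split_closed; intros;
  repeat match goal with H : _ ∈c X |- _ =>
    apply HX in H as [?%in_fin_formulas ?] end;
  apply HX; rewrite in_fin_formulas.
- split; [intros Y (C & _); now apply C | now apply H1].
- split; [intros Y (_ & C & _); now apply C | now apply H2].
- split; [intros Y (_ & _ & C & _); now apply C | now apply H3].
- split; [intros Y (_ & _ & _ & C & _); now apply C | now apply H4].
- split; [| now apply H5].
  intros Y HY; apply (proj1 (proj2 (proj2 (proj2 (proj2 HY))))).
  match goal with H : fin_formula _ |- _ => exact (H Y HY) end.
- split; [| now apply H6].
  intros Y HY; apply (proj1 (proj2 (proj2 (proj2 (proj2 (proj2 HY))))));
  match goal with H : fin_formula ?φ |- ?φ ∈c _ => exact (H Y HY) end.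
- split; [| now apply H7].
  intros Y HY; apply (proj2 (proj2 (proj2 (proj2 (proj2 (proj2 HY))))));
  [assumption |].
  match goal with H : fin_formula _ |- _ => exact (H Y HY) end.
Qed.

Lemma fin_inv φ : fin_formula φ ->
  (exists x y, φ = cEq x y /\ is_natural x /\ is_natural y) \/
  (exists x y, φ = cIn x y /\ is_natural x /\ is_natural y) \/
  (exists x, φ = cA x /\ is_natural x) \/
  (exists x y z, φ = cTr x y z /\ is_natural x /\ is_natural y /\ is_natural z) \/
  (exists ψ, φ = cNeg ψ /\ ψ ∈ fin_formulas) \/
  (exists ψ χ, φ = cAnd ψ χ /\ ψ ∈ fin_formulas /\ χ ∈ fin_formulas) \/
  (exists x ψ, φ = cAll x ψ /\ is_natural x /\ ψ ∈ fin_formulas).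
Proof.
revert φ; apply fin_ind; [def | ..].
- intros x y Hx Hy; left; now exists x, y.
- intros x y Hx Hy; right; left; now exists x, y.
- intros x Hx; do 2 right; left; now exists x.
- intros x y z Hx Hy Hz; do 3 right; left; now exists x, y, z.
- intros ψ Hψ _; do 4 right; left.
  exists ψ; now rewrite in_fin_formulas.
- intros ψ χ Hψ Hχ _ _; do 5 right; left.
  exists ψ, χ; now rewrite !in_fin_formulas.
- intros x ψ Hx Hψ _; do 6 right.
  exists x, ψ; now rewrite in_fin_formulas.
Qed.
End Formulas.

(** * Free variables and valuations *)

Section Free.
Context {M : GBC_model}.
Notation V := (sets M).
Notation env := (nat -> sets M).

Definition free_step (s v φ : V) : Prop :=
  (exists x y, φ = cEq x y /\ (v = x \/ v = y)) \/
  (exists x y, φ = cIn x y /\ (v = x \/ v = y)) \/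
  (exists x, φ = cA x /\ v = x) \/
  (exists x y z, φ = cTr x y z /\ (v = x \/ v = y \/ v = z)) \/
  (exists ψ, φ = cNeg ψ /\ ⟨v, ψ⟩ ∈ s) \/
  (exists Φ ψ, φ = cConj Φ /\ ψ ∈ Φ /\ ⟨v, ψ⟩ ∈ s) \/
  (exists ψ χ, φ = cAnd ψ χ /\ (⟨v, ψ⟩ ∈ s \/ ⟨v, χ⟩ ∈ s)) \/
  (exists x ψ, φ = cAll x ψ /\ v <> x /\ ⟨v, ψ⟩ ∈ s).

(** A derivation in set form: every pair in s follows by one clause from pairs in s. The existence
    of such a set replaces the quantifier over classes in [free]. *)
Definition free_witness (s : V) : Prop :=
  forall v φ, ⟨v, φ⟩ ∈ s -> free_step s v φ.

Lemma free_step_mono s s' v φ :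
  subset s s' -> free_step s v φ -> free_step s' v φ.
Proof.
intros Hs [H | [H | [H | [H | [H | [H | [H | H]]]]]]].
- now left.
- now right; left.
- now do 2 right; left.
- now do 3 right; left.
- do 4 right; left; destruct H as (ψ & E & H); eauto.
- do 5 right; left; destruct H as (Φ & ψ & E & H1 & H); exists Φ, ψ; auto.
- do 6 right; left; destruct H as (ψ & χ & E & H); exists ψ, χ; intuition.
- do 7 right; destruct H as (x & ψ & E & H1 & H); exists x, ψ; auto.
Qed.

Definition free_wit (v φ : V) : Prop :=
  exists s, free_witness s /\ ⟨v, φ⟩ ∈ s.

(** Each clause has at most one premise, so a witness is prolonged by a single pair and no two
    witnesses have to be merged. *)
Lemma free_wit_add s v φ :
  free_witness s -> free_step s v φ -> free_wit v φ.
Proof.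
intros Hs H; exists (adjoin s ⟨v, φ⟩).
assert (Hsub : subset s (adjoin s ⟨v, φ⟩)) by (intros z Hz; apply in_adjoin; auto).
split; [| apply in_adjoin; auto].
intros w ψ Hw; apply (free_step_mono s); [assumption |].
apply in_adjoin in Hw as [Hw | E]; [auto |].
now apply opair_inj in E as [-> ->].
Qed.

Lemma free_witness_empty : free_witness (empty M).
Proof. intros v φ H; destruct (in_empty _ H). Qed.

Lemma tc_opair_r (x y : V) z : z ∈ tc y \/ z = y -> z ∈ tc ⟨x, y⟩.
Proof.
intro H; assert (Hy : y ∈ tc ⟨x, y⟩).
{ apply (tc_transitive _ (upair x y)); [apply in_upair; auto |].
  apply in_tc; unfold opair; apply in_upair; auto. }
destruct H as [H | ->]; [exact (tc_mono _ _ Hy z H) | exact Hy].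
Qed.

Lemma tc_opair_l (x y : V) : x ∈ tc ⟨x, y⟩.
Proof.
apply (tc_transitive _ (upair x y)); [apply in_upair; auto |].
apply in_tc; unfold opair; apply in_upair; auto.
Qed.

Lemma tc_neg (φ : V) : φ ∈ tc (cNeg φ).
Proof. apply tc_opair_r; now right. Qed.

Lemma tc_conj (Φ φ : V) : φ ∈ Φ -> φ ∈ tc (cConj Φ).
Proof. intro H; apply tc_opair_r; left; now apply in_tc. Qed.

Lemma tc_and_l (φ ψ : V) : φ ∈ tc (cAnd φ ψ).
Proof. apply tc_opair_r; left; apply tc_opair_l. Qed.

Lemma tc_and_r (φ ψ : V) : ψ ∈ tc (cAnd φ ψ).
Proof. apply tc_opair_r; left; apply tc_opair_r; now right. Qed.

Lemma tc_all (x φ : V) : φ ∈ tc (cAll x φ).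
Proof. apply tc_opair_r; left; apply tc_opair_r; now right. Qed.

Lemma free_char (v φ : V) : free v φ <-> free_wit v φ.
Proof.
split.
- destruct (class_of (fun p => exists v φ, p = ⟨v, φ⟩ /\ free_wit v φ)) as [X HX].
  { unfold free_wit, free_witness, free_step; def. }
  assert (HX' : forall v φ, ⟨v, φ⟩ ∈c X <-> free_wit v φ).
  { intros w ψ; rewrite HX; split; [| eauto].
    intros (w' & ψ' & E & H); apply opair_inj in E as [-> ->]; exact H. }
  intro H; apply HX', H; clear v φ H.
  assert (H0 := free_witness_empty).
  split_closed.
  + intros x y; rewrite !HX'; split; apply (free_wit_add _ _ _ H0);
      left; eauto 6.
  + intros x y; rewrite !HX'; split; apply (free_wit_add _ _ _ H0);
      right; left; eauto 6.
  + intros x; rewrite !HX'; apply (free_wit_add _ _ _ H0);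
      do 2 right; left; eauto 6.
  + intros x y z; rewrite !HX'; repeat split; apply (free_wit_add _ _ _ H0);
      do 3 right; left; exists x, y, z; auto.
  + intros v φ; rewrite !HX'; intros (s & Hs & H); apply (free_wit_add _ _ _ Hs).
    do 4 right; left; eauto.
  + intros v φ Φ Hφ; rewrite !HX'; intros (s & Hs & H).
    apply (free_wit_add _ _ _ Hs); do 5 right; left; eauto.
  + intros v φ ψ; rewrite !HX'.
    intros [(s & Hs & H) | (s & Hs & H)]; apply (free_wit_add _ _ _ Hs);
      do 6 right; left; eauto 6.
  + intros v x φ; rewrite !HX'; intros (s & Hs & H) Hv.
    apply (free_wit_add _ _ _ Hs); do 7 right; eauto.
- intros (s & Hs & H) R HR.
  destruct HR as (R1 & R2 & R3 & R4 & R5 & R6 & R7 & R8).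
  (* The definition of a witness does not itself forbid circular justifications. They are ruled out
     because the components of a code lie in its transitive closure. *)
  revert φ H; apply (tc_ind (fun φ => ⟨v, φ⟩ ∈ s -> ⟨v, φ⟩ ∈c R)); [def |].
  intros φ IH H.
  destruct (Hs v φ H) as [D | [D | [D | [D | [D | [D | [D | D]]]]]]].
  + destruct D as (x & y & -> & [-> | ->]); apply R1.
  + destruct D as (x & y & -> & [-> | ->]); apply R2.
  + destruct D as (x & -> & ->); apply R3.
  + destruct D as (x & y & z & -> & [-> | [-> | ->]]); apply R4.
  + destruct D as (ψ & -> & D); apply R5, IH; [apply tc_neg | exact D].
  + destruct D as (Φ & ψ & -> & D1 & D); apply (R6 v ψ Φ D1), IH;
      [now apply tc_conj | exact D].
  + destruct D as (ψ & χ & -> & [D | D]); apply R7; [left | right]; apply IH;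
      auto using tc_and_l, tc_and_r.
  + destruct D as (x & ψ & -> & D1 & D); apply R8; [| exact D1].
    apply IH; [apply tc_all | exact D].
Qed.

Lemma Def_free (t u : env -> V) :
  DefT t -> DefT u -> Def (fun e => free (t e) (u e)).
Proof.
apply (Def_comp2 (fun v φ => free v φ)).
apply (Def_equiv (fun e => free_wit (e 0) (e 1))).
- intro e; symmetry; apply free_char.
- unfold free_wit, free_witness, free_step; def.
Qed.

Lemma free_inv (v φ : V) : free v φ ->
  (exists x y, φ = cEq x y /\ (v = x \/ v = y)) \/
  (exists x y, φ = cIn x y /\ (v = x \/ v = y)) \/
  (exists x, φ = cA x /\ v = x) \/
  (exists x y z, φ = cTr x y z /\ (v = x \/ v = y \/ v = z)) \/
  (exists ψ, φ = cNeg ψ /\ free v ψ) \/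
  (exists Φ ψ, φ = cConj Φ /\ ψ ∈ Φ /\ free v ψ) \/
  (exists ψ χ, φ = cAnd ψ χ /\ (free v ψ \/ free v χ)) \/
  (exists x ψ, φ = cAll x ψ /\ v <> x /\ free v ψ).
Proof.
rewrite free_char; intros (s & Hs & H).
assert (HF : forall ψ, ⟨v, ψ⟩ ∈ s -> free v ψ)
  by (intros ψ Hψ; apply free_char; now exists s).
destruct (Hs v φ H) as [D | [D | [D | [D | [D | [D | [D | D]]]]]]].
- now left.
- now right; left.
- now do 2 right; left.
- now do 3 right; left.
- do 4 right; left; destruct D as (ψ & E & D); eauto.
- do 5 right; left; destruct D as (Φ & ψ & E & D1 & D); exists Φ, ψ; auto.
- do 6 right; left; destruct D as (ψ & χ & E & D); exists ψ, χ; intuition.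
- do 7 right; destruct D as (x & ψ & E & D1 & D); exists x, ψ; auto.
Qed.

Ltac inv_free H :=
  apply free_inv in H as [H | [H | [H | [H | [H | [H | [H | H]]]]]]];
  repeat match type of H with exists _, _ => destruct H as [? H] end;
  destruct H as [? H]; inv_codes.

Lemma free_eq (v x y : V) : free v (cEq x y) <-> v = x \/ v = y.
Proof.
split; [intro H; inv_free H; exact H |].
intros [-> | ->] R (HR & _); apply HR.
Qed.

Lemma free_in (v x y : V) : free v (cIn x y) <-> v = x \/ v = y.
Proof.
split; [intro H; inv_free H; exact H |].
intros [-> | ->] R (_ & HR & _); apply HR.
Qed.

Lemma free_A (v x : V) : free v (cA x) <-> v = x.
Proof.
split; [intro H; inv_free H; reflexivity |].
intros -> R (_ & _ & HR & _); apply HR.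
Qed.

Lemma free_Tr (v x y z : V) : free v (cTr x y z) <-> v = x \/ v = y \/ v = z.
Proof.
split; [intro H; inv_free H; exact H |].
intros H R (_ & _ & _ & HR & _); destruct H as [-> | [-> | ->]]; apply HR.
Qed.

Lemma free_neg (v φ : V) : free v (cNeg φ) <-> free v φ.
Proof.
split; [intro H; inv_free H; exact H |].
intros H R HR; assert (HR' := HR); destruct HR' as (_ & _ & _ & _ & HR' & _).
exact (HR' v φ (H R HR)).
Qed.

Lemma free_conj (v Φ : V) : free v (cConj Φ) <-> exists φ, φ ∈ Φ /\ free v φ.
Proof.
split; [intro H; inv_free H; eauto |].
intros (φ & Hφ & H) R HR; assert (HR' := HR).
destruct HR' as (_ & _ & _ & _ & _ & HR' & _).
exact (HR' v φ Φ Hφ (H R HR)).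
Qed.

Lemma free_and (v φ ψ : V) : free v (cAnd φ ψ) <-> free v φ \/ free v ψ.
Proof.
split; [intro H; inv_free H; exact H |].
intros H R HR; assert (HR' := HR).
destruct HR' as (_ & _ & _ & _ & _ & _ & HR' & _); apply HR'.
destruct H as [H | H]; [left | right]; exact (H R HR).
Qed.

Lemma free_all (v x φ : V) : free v (cAll x φ) <-> v <> x /\ free v φ.
Proof.
split; [intro H; inv_free H; exact H |].
intros [Hv H] R HR; assert (HR' := HR).
destruct HR' as (_ & _ & _ & _ & _ & _ & _ & HR').
exact (HR' v x φ (H R HR) Hv).
Qed.

Lemma fin_free_natural (φ : V) : fin_formula φ -> forall v, free v φ -> is_natural v.
Proof.
revert φ; apply (fin_ind (fun φ => forall v, free v φ -> is_natural v));
  [def; apply Def_free; def | ..].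
- intros x y Hx Hy v; rewrite free_eq; intros [-> | ->]; assumption.
- intros x y Hx Hy v; rewrite free_in; intros [-> | ->]; assumption.
- intros x Hx v; rewrite free_A; intros ->; assumption.
- intros x y z Hx Hy Hz v; rewrite free_Tr; intros [-> | [-> | ->]]; assumption.
- intros φ _ IH v; rewrite free_neg; apply IH.
- intros φ ψ _ _ IH1 IH2 v; rewrite free_and; intros [H | H]; eauto.
- intros x φ _ _ IH v; rewrite free_all; intros [_ H]; eauto.
Qed.

(** The condition [is_natural] bounds the collection by [omega], so that separation applies. *)
Definition free_set (φ : V) : V := setof (fun v => is_natural v /\ free v φ).

Lemma in_free_set φ v : fin_formula φ -> (v ∈ free_set φ <-> free v φ).
Proof.
intro Hφ; unfold free_set; rewrite in_setof.
- split; [tauto | eauto using fin_free_natural].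
- destruct (separation (fun v => free v φ) omega) as [s Hs].
  { apply Def_free; def. }
  exists s; intro z; now rewrite Hs, in_omega.
Qed.

Lemma DefT_free_set (t : env -> V) : DefT t -> DefT (fun e => free_set (t e)).
Proof.
apply (DefT_comp (fun φ => free_set φ)); unfold free_set; def; apply Def_free; def.
Qed.

Lemma Def_is_valuation (t u : env -> V) :
  DefT t -> DefT u -> Def (fun e => is_valuation (t e) (u e)).
Proof.
apply (Def_comp2 (fun v φ => is_valuation v φ)); unfold is_valuation; def.
apply Def_free; def.
Qed.

Lemma valuation_pair (a φ p : V) : is_valuation a φ -> p ∈ a ->
  exists v b, p = ⟨v, b⟩ /\ free v φ.
Proof.
intros [[Ha _] Hd] Hp; destruct (Ha p Hp) as (v & b & ->).
exists v, b; split; [reflexivity |]; apply Hd; eauto.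
Qed.

Lemma valuation_restrict (a φ : V) : is_function a ->
  (forall v, free v φ -> exists b, ⟨v, b⟩ ∈ a) ->
  exists a', is_valuation a' φ /\ subset a' a.
Proof.
intros [Ha Hf] Hd.
destruct (separation (fun p => exists v b, p = ⟨v, b⟩ /\ free v φ) a) as [a' Ha'].
{ def; apply Def_free; def. }
exists a'; split; [split; [split |] |].
- intros p Hp; apply Ha, Ha', Hp.
- intros x y y' Hy Hy'; apply Ha' in Hy as [Hy _], Hy' as [Hy' _]; eauto.
- intro v; split.
  + intros [b Hb]; apply Ha' in Hb as (_ & w & c & E & Hw).
    now apply opair_inj in E as [-> _].
  + intro Hv; destruct (Hd v Hv) as [b Hb]; exists b; apply Ha'; eauto.
- intros p Hp; now apply Ha'.
Qed.

Lemma valuation_unique (a φ a1 a2 : V) : is_function a ->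
  is_valuation a1 φ -> subset a1 a -> is_valuation a2 φ -> subset a2 a -> a1 = a2.
Proof.
intros [_ Hf]; revert a1 a2.
assert (H : forall a1 a2, is_valuation a1 φ -> subset a1 a ->
  is_valuation a2 φ -> subset a2 a -> subset a1 a2).
{ intros a1 a2 H1 S1 H2 S2 p Hp.
  destruct (valuation_pair _ _ _ H1 Hp) as (v & b & -> & Hv).
  apply (proj2 H2) in Hv as [c Hc].
  now rewrite (Hf v b c (S1 _ Hp) (S2 _ Hc)). }
intros a1 a2 H1 S1 H2 S2; apply ext; intro p; split; apply H; assumption.
Qed.
End Free.

Ltac def_pred ::=
  first
  [ simple apply Def_transitive | simple apply Def_subset
  | simple apply Def_free | simple apply Def_is_valuation
  | progress unfold is_natural, is_inductive, is_empty, is_succ, is_ordinal,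
      is_function ].

(** * Finite assignments and the formation of infinitary formulas *)

Section Assignments.
Context {M : GBC_model}.
Notation V := (sets M).
Notation env := (nat -> sets M).

Fixpoint assignment (k : nat) (e : env) : V :=
  match k with
  | 0 => empty M
  | S k => adjoin (assignment k e) ⟨numeral M k, e k⟩
  end.

Lemma in_assignment k e p :
  p ∈ assignment k e <-> exists i, i < k /\ p = ⟨numeral M i, e i⟩.
Proof.
induction k as [| k IH]; cbn.
- split; [intro H; destruct (in_empty _ H) | intros [i [H _]]; lia].
- rewrite in_adjoin, IH; split.
  + intros [(i & Hi & ->) | ->]; [exists i | exists k]; auto with arith.
  + intros (i & Hi & ->); destruct (Nat.eq_dec i k) as [-> | Hn]; [now right |].
    left; exists i; split; [lia | reflexivity].
Qed.

Lemma assignment_pair k e i b :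
  ⟨numeral M i, b⟩ ∈ assignment k e <-> i < k /\ b = e i.
Proof.
rewrite in_assignment; split.
- intros (j & Hj & E); apply opair_inj in E as [E ->].
  now apply numeral_inj in E as ->.
- intros [Hi ->]; eauto.
Qed.

Lemma assignment_function k e : is_function (assignment k e).
Proof.
split.
- intros p Hp; apply in_assignment in Hp as (i & _ & ->); eauto.
- intros x y y' H H'; assert (H0 := H); apply in_assignment in H0 as (i & _ & E).
  apply opair_inj in E as [-> _].
  apply assignment_pair in H as [_ ->], H' as [_ ->]; reflexivity.
Qed.

Lemma numeral_finite k : is_finite (numeral M k).
Proof.
destruct (image (fun x : V => ⟨x, x⟩) (fun _ => True) (numeral M k)) as [f Hf];
  [def | def |].
assert (Hf' : forall x y, ⟨x, y⟩ ∈ f <-> x ∈ numeral M k /\ y = x).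
{ intros x y; rewrite Hf; split.
  - intros (z & Hz & _ & E); apply opair_inj in E as [-> ->]; auto.
  - intros [Hx ->]; eauto. }
exists (numeral M k), f; split; [apply natural_numeral |].
split; [split | split; [| split]].
- intros p Hp; apply Hf in Hp as (z & _ & _ & ->); eauto.
- intros x y y' H H'; apply Hf' in H as [_ ->], H' as [_ ->]; reflexivity.
- intro x; split; [intros [y Hy]; now apply Hf' in Hy |].
  intro Hx; exists x; now apply Hf'.
- intro y; split; [intros [x Hx]; now apply Hf' in Hx as [Hx ->] |].
  intro Hy; exists y; now apply Hf'.
- intros x x' y H H'; apply Hf' in H as [_ ->], H' as [_ ->]; reflexivity.
Qed.

Definition upd (e : env) (i : nat) (b : V) : env :=
  fun n => if Nat.eqb n i then b else e n.

Lemma upd_same e i b : upd e i b i = b.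
Proof. unfold upd; now rewrite Nat.eqb_refl. Qed.

Lemma upd_other e i b n : n <> i -> upd e i b n = e n.
Proof. intro H; unfold upd; apply Nat.eqb_neq in H; now rewrite H. Qed.

(** Each closed class X is cut down to those members whose negated formula, if they are negations,
    is again in X. The smaller class is still closed, so it contains [cNeg φ], and X contains φ. *)
Lemma inf_neg_inv φ : inf_formula (M := M) (cNeg φ) -> inf_formula φ.
Proof.
intros H X HX.
destruct (class_of (fun ψ => ψ ∈c X /\ forall χ, ψ = cNeg χ -> χ ∈c X))
  as [Y HY]; [def |].
assert (HYX : forall ψ, ψ ∈c Y -> ψ ∈c X) by (intros ψ Hψ; now apply HY).
enough (HC : inf_closed Y) by exact (proj2 (proj1 (HY _) (H Y HC)) φ eq_refl).
destruct HX as (H1 & H2 & H3 & H4 & H5 & H6).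
split_closed.
- intros x y Hx Hy; apply HY; split; [now apply H1 | intros; inv_codes].
- intros x y Hx Hy; apply HY; split; [now apply H2 | intros; inv_codes].
- intros x Hx; apply HY; split; [now apply H3 | intros; inv_codes].
- intros ψ Hψ; apply HY; split; [apply H4, HYX, Hψ |].
  intros; inv_codes; apply HYX, Hψ.
- intros Φ HΦ Hf; apply HY; split; [| intros; inv_codes].
  apply H5; [intros ψ Hψ; apply HYX, HΦ, Hψ | exact Hf].
- intros x ψ Hx Hψ; apply HY; split; [| intros; inv_codes].
  apply H6; [exact Hx | apply HYX, Hψ].
Qed.

Lemma inf_neg φ : inf_formula (M := M) φ -> inf_formula (cNeg φ).
Proof.
intros H X HX; assert (HX' := HX); destruct HX' as (_ & _ & _ & C & _).
apply C, (H X HX).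
Qed.

Lemma inf_all i φ :
  inf_formula (M := M) φ -> inf_formula (cAll (numeral M i) φ).
Proof.
intros H X HX; assert (HX' := HX); destruct HX' as (_ & _ & _ & _ & _ & C).
apply C; [apply natural_numeral | apply (H X HX)].
Qed.

Lemma inf_conj k Φ : (forall φ, φ ∈ Φ -> inf_formula (M := M) φ) ->
  (forall v φ, φ ∈ Φ -> free v φ -> v ∈ numeral M k) ->
  inf_formula (cConj Φ).
Proof.
intros H Hf X HX; assert (HX' := HX); destruct HX' as (_ & _ & _ & _ & C & _).
apply C; [intros φ Hφ; apply (H φ Hφ X HX) |].
exists (numeral M k); split; [apply numeral_finite | exact Hf].
Qed.
End Assignments.

(** * Satisfaction of infinitary formulas in eight variables *)

Section Truth.
Context {M : GBC_model}.
Notation V := (sets M).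
Notation env := (nat -> sets M).
Context (A T : classes M).
Hypothesis truth_T : is_truth_predicate A T.

Lemma true_at_valuation φ a a' : is_function a -> is_valuation a' φ ->
  subset a' a -> (true_at T φ a <-> ⟨φ, a'⟩ ∈c T).
Proof.
intros Ha Hv Hs; split.
- intros (b & Hb & Hsb & H).
  now rewrite (valuation_unique _ _ _ _ Ha Hv Hs Hb Hsb).
- intro H; now exists a'.
Qed.

(** Both functions restrict to the same valuation of φ. *)
Lemma true_at_mono φ a a' : is_function a -> subset a' a ->
  (forall v, free v φ -> exists b, ⟨v, b⟩ ∈ a') ->
  (true_at T φ a' <-> true_at T φ a).
Proof.
intros Ha Hs Hd.
assert (Ha' : is_function a').
{ split; [intros p Hp; apply Ha, Hs, Hp |].
  intros x y y' H H'; apply (proj2 Ha x); now apply Hs. }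
destruct (valuation_restrict _ _ Ha' Hd) as (b & Hb & Hsb).
rewrite (true_at_valuation _ _ _ Ha' Hb Hsb).
rewrite (true_at_valuation _ _ _ Ha Hb); [reflexivity |].
intros p Hp; apply Hs, Hsb, Hp.
Qed.

(* Eight variables suffice for all the infinitary formulas needed below. *)
Definition Sat (φ : V) (e : env) : Prop := true_at T φ (assignment 8 e).

Definition bounded (φ : V) : Prop :=
  forall v, free v φ -> exists i, i < 8 /\ v = numeral M i.

Lemma bounded_valuation φ e : bounded φ ->
  exists a, is_valuation a φ /\ subset a (assignment 8 e).
Proof.
intro H; apply valuation_restrict; [apply assignment_function |].
intros v Hv; destruct (H v Hv) as (i & Hi & ->).
exists (e i); now apply assignment_pair.
Qed.

Lemma Sat_valuation φ a e : is_valuation a φ -> subset a (assignment 8 e) ->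
  (Sat φ e <-> ⟨φ, a⟩ ∈c T).
Proof. apply true_at_valuation, assignment_function. Qed.

Lemma valuation_num φ a e i : is_valuation a φ -> subset a (assignment 8 e) ->
  free (numeral M i) φ -> ⟨numeral M i, e i⟩ ∈ a.
Proof.
intros Ha Hs Hf; apply (proj2 Ha) in Hf as [b Hb].
assert (Hb' := Hs _ Hb); apply assignment_pair in Hb' as [_ ->]; exact Hb.
Qed.

Lemma valuation_value φ a e i b : is_valuation a φ ->
  subset a (assignment 8 e) -> ⟨numeral M i, b⟩ ∈ a -> b = e i.
Proof. intros Ha Hs Hb; now apply Hs, assignment_pair in Hb. Qed.

Lemma Sat_neg φ e : inf_formula φ -> bounded φ ->
  (Sat (cNeg φ) e <-> ~ Sat φ e).
Proof.
intros Hi Hb; destruct (bounded_valuation _ e Hb) as (a & Ha & Hs).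
assert (Ha' : is_valuation a (cNeg φ)).
{ destruct Ha as [Ha Hd]; split; [exact Ha |].
  intro v; now rewrite free_neg. }
rewrite (Sat_valuation _ _ _ Ha' Hs), (Sat_valuation _ _ _ Ha Hs).
apply (truth_neg truth_T); [now apply inf_neg | exact Ha'].
Qed.

Lemma Sat_conj Φ e : inf_formula (cConj Φ) -> bounded (cConj Φ) ->
  (Sat (cConj Φ) e <-> forall φ, φ ∈ Φ -> Sat φ e).
Proof.
intros Hi Hb; destruct (bounded_valuation _ e Hb) as (a & Ha & Hs).
rewrite (Sat_valuation _ _ _ Ha Hs), (truth_conj truth_T) by assumption.
assert (H : forall φ, φ ∈ Φ -> (true_at T φ a <-> Sat φ e)).
{ intros φ Hφ; apply true_at_mono; [apply assignment_function | exact Hs |].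
  intros v Hv; apply Ha, free_conj; eauto. }
split; intros H' φ Hφ; now apply H, H'.
Qed.

Lemma Sat_all i φ e : i < 8 -> inf_formula φ -> bounded φ ->
  (Sat (cAll (numeral M i) φ) e <-> forall b, Sat φ (upd e i b)).
Proof.
intros Hi Hφ Hb.
assert (Hb' : bounded (cAll (numeral M i) φ)).
{ intros v Hv; apply free_all in Hv as [_ Hv]; auto. }
destruct (bounded_valuation _ e Hb') as (a & Ha & Hs).
rewrite (Sat_valuation _ _ _ Ha Hs), (truth_all truth_T)
  by (assumption || now apply inf_all).
assert (H : forall b, true_at T φ (adjoin a ⟨numeral M i, b⟩) <-> Sat φ (upd e i b)).
{ intro b; apply true_at_mono; [apply assignment_function | |].
  - intros p Hp; apply in_adjoin in Hp as [Hp | ->].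
    + destruct (valuation_pair _ _ _ Ha Hp) as (v & c & -> & Hv).
      destruct (Hb' v Hv) as (j & Hj & ->).
      apply assignment_pair; split; [exact Hj |].
      rewrite (valuation_value _ _ _ _ _ Ha Hs Hp).
      apply free_all in Hv as [Hv _]; rewrite upd_other; congruence.
    + apply assignment_pair; now rewrite upd_same.
  - intros v Hv; destruct (classic (v = numeral M i)) as [-> | Hn].
    + exists b; apply in_adjoin; auto.
    + destruct (proj2 (proj2 Ha v)) as [c Hc]; [now apply free_all |].
      exists c; apply in_adjoin; auto. }
split; intros H' b; apply H, H'.
Qed.

(** The list [l] merely bounds the free variables. It is tracked so that a finished formula can be
    seen to have at most v_0 free. *)
Definition Rep (φ : V) (l : list nat) (P : env -> Prop) : Prop :=
  inf_formula φ /\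
  (forall v, free v φ -> exists i, In i l /\ v = numeral M i) /\
  (forall i, In i l -> i < 8) /\
  forall e, Sat φ e <-> P e.

Lemma Rep_bounded φ l P : Rep φ l P -> bounded φ.
Proof. intros (_ & Hf & Hl & _) v Hv; destruct (Hf v Hv) as (i & Hi & ->); eauto. Qed.

Lemma Rep_equiv φ l l' P Q : Rep φ l P -> incl l l' -> (forall i, In i l' -> i < 8) ->
  (forall e, P e <-> Q e) -> Rep φ l' Q.
Proof.
intros (Hi & Hf & Hl & H) Hll Hl' HPQ; repeat split; auto.
- intros v Hv; destruct (Hf v Hv) as (i & Hin & ->); eauto.
- intro H'; now apply HPQ, H.
- intro H'; now apply H, HPQ.
Qed.

Lemma Rep_eq i j : i < 8 -> j < 8 ->
  Rep (cEq (numeral M i) (numeral M j)) [i; j] (fun e => e i = e j).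
Proof.
intros Hi Hj; assert (HI : inf_formula (cEq (numeral M i) (numeral M j))).
{ intros X (C & _); apply C; apply natural_numeral. }
assert (Hf : forall v, free v (cEq (numeral M i) (numeral M j)) ->
  exists k, In k [i; j] /\ v = numeral M k).
{ intros v Hv; apply free_eq in Hv as [-> | ->]; [exists i | exists j]; cbn; auto. }
assert (Hl : forall k, In k [i; j] -> k < 8)
  by (intros k [<- | [<- | []]]; assumption).
repeat split; [exact HI | exact Hf | exact Hl | |]; intro H;
(destruct (bounded_valuation (cEq (numeral M i) (numeral M j)) e) as (a & Ha & Hs);
  [intros v Hv; destruct (Hf v Hv) as (k & Hk & ->); eauto |]).
- apply (Sat_valuation _ _ _ Ha Hs), (truth_eq truth_T) in H; trivial.
  destruct H as (b & c & Hb & Hc & <-).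
  now rewrite <- (valuation_value _ _ _ _ _ Ha Hs Hb),
    <- (valuation_value _ _ _ _ _ Ha Hs Hc).
- apply (Sat_valuation _ _ _ Ha Hs), (truth_eq truth_T); trivial.
  exists (e i), (e j); repeat split; trivial;
    apply (valuation_num _ _ _ _ Ha Hs), free_eq; auto.
Qed.

Lemma Rep_in i j : i < 8 -> j < 8 ->
  Rep (cIn (numeral M i) (numeral M j)) [i; j] (fun e => e i ∈ e j).
Proof.
intros Hi Hj; assert (HI : inf_formula (cIn (numeral M i) (numeral M j))).
{ intros X (_ & C & _); apply C; apply natural_numeral. }
assert (Hf : forall v, free v (cIn (numeral M i) (numeral M j)) ->
  exists k, In k [i; j] /\ v = numeral M k).
{ intros v Hv; apply free_in in Hv as [-> | ->]; [exists i | exists j]; cbn; auto. }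
assert (Hl : forall k, In k [i; j] -> k < 8)
  by (intros k [<- | [<- | []]]; assumption).
repeat split; [exact HI | exact Hf | exact Hl | |]; intro H;
(destruct (bounded_valuation (cIn (numeral M i) (numeral M j)) e) as (a & Ha & Hs);
  [intros v Hv; destruct (Hf v Hv) as (k & Hk & ->); eauto |]).
- apply (Sat_valuation _ _ _ Ha Hs), (truth_in truth_T) in H; trivial.
  destruct H as (b & c & Hb & Hc & H).
  now rewrite <- (valuation_value _ _ _ _ _ Ha Hs Hb),
    <- (valuation_value _ _ _ _ _ Ha Hs Hc).
- apply (Sat_valuation _ _ _ Ha Hs), (truth_in truth_T); trivial.
  exists (e i), (e j); repeat split; trivial;
    apply (valuation_num _ _ _ _ Ha Hs), free_in; auto.
Qed.

Lemma Rep_A i : i < 8 -> Rep (cA (numeral M i)) [i] (fun e => e i ∈c A).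
Proof.
intros Hi; assert (HI : inf_formula (cA (numeral M i))).
{ intros X (_ & _ & C & _); apply C; apply natural_numeral. }
assert (Hf : forall v, free v (cA (numeral M i)) ->
  exists k, In k [i] /\ v = numeral M k).
{ intros v Hv; apply free_A in Hv as ->; exists i; cbn; auto. }
assert (Hl : forall k, In k [i] -> k < 8)
  by (intros k [<- | []]; assumption).
repeat split; [exact HI | exact Hf | exact Hl | |]; intro H;
(destruct (bounded_valuation (cA (numeral M i)) e) as (a & Ha & Hs);
  [intros v Hv; destruct (Hf v Hv) as (k & Hk & ->); eauto |]).
- apply (Sat_valuation _ _ _ Ha Hs), (truth_A truth_T) in H; trivial.
  destruct H as (b & Hb & H).
  now rewrite <- (valuation_value _ _ _ _ _ Ha Hs Hb).
- apply (Sat_valuation _ _ _ Ha Hs), (truth_A truth_T); trivial.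
  exists (e i); split; trivial.
  apply (valuation_num _ _ _ _ Ha Hs), free_A; auto.
Qed.

Lemma Rep_neg φ l P : Rep φ l P -> Rep (cNeg φ) l (fun e => ~ P e).
Proof.
intro R; assert (Hb := Rep_bounded _ _ _ R); destruct R as (Hi & Hf & Hl & H).
split; [now apply inf_neg |]; split; [| split; [exact Hl |]].
- intros v Hv; now apply Hf, free_neg.
- intro e; now rewrite Sat_neg, H.
Qed.

Definition kAll (i : nat) (φ : V) : V := cAll (numeral M i) φ.

Lemma Rep_all i φ l P : i < 8 -> Rep φ l P ->
  Rep (kAll i φ) (remove Nat.eq_dec i l) (fun e => forall b, P (upd e i b)).
Proof.
unfold kAll; intros Hi8 R; assert (Hb := Rep_bounded _ _ _ R).
destruct R as (Hi & Hf & Hl & H).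
split; [now apply inf_all |]; split; [| split].
- intros v Hv; apply free_all in Hv as [Hn Hv].
  destruct (Hf v Hv) as (j & Hj & ->); exists j; split; [| reflexivity].
  apply in_in_remove; congruence.
- intros j Hj; now apply in_remove in Hj as [Hj _]; apply Hl.
- intro e; rewrite Sat_all by assumption; split; intros H' b; apply H, H'.
Qed.

(** A single list [l] for all members keeps the free variables finite in number, however large the
    set Φ is. *)
Lemma Rep_conj l (P : V -> env -> Prop) Φ : (forall i, In i l -> i < 8) ->
  (forall φ, φ ∈ Φ -> Rep φ l (P φ)) ->
  Rep (cConj Φ) l (fun e => forall φ, φ ∈ Φ -> P φ e).
Proof.
intros Hl R.
assert (Hf : forall v, free v (cConj Φ) -> exists i, In i l /\ v = numeral M i).
{ intros v Hv; apply free_conj in Hv as (φ & Hφ & Hv).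
  exact (proj1 (proj2 (R φ Hφ)) v Hv). }
assert (HI : inf_formula (cConj Φ)).
{ apply (inf_conj 8); [intros φ Hφ; apply (R φ Hφ) |].
  intros v φ Hφ Hv; apply in_numeral; apply (Rep_bounded _ _ _ (R φ Hφ)), Hv. }
split; [exact HI |]; split; [exact Hf |]; split; [exact Hl |].
intro e; rewrite Sat_conj; [| exact HI |].
- split; intros H φ Hφ; now apply (R φ Hφ), H.
- intros v Hv; destruct (Hf v Hv) as (i & Hi & ->); eauto.
Qed.

(** The infinitary language conjoins sets of formulas, so the binary conjunction is taken over an
    unordered pair; the other connectives are reduced to it and to negation. *)
Definition kAnd (φ ψ : V) : V := cConj (upair φ ψ).
Definition kOr (φ ψ : V) : V := cNeg (kAnd (cNeg φ) (cNeg ψ)).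
Definition kImp (φ ψ : V) : V := cNeg (kAnd φ (cNeg ψ)).
Definition kIff (φ ψ : V) : V := kAnd (kImp φ ψ) (kImp ψ φ).
Definition kEx (i : nat) (φ : V) : V := cNeg (cAll (numeral M i) (cNeg φ)).
Definition kEq (i j : nat) : V := cEq (numeral M i) (numeral M j).
Definition kIn (i j : nat) : V := cIn (numeral M i) (numeral M j).
Definition kDisj (Ψ : V) : V :=
  cNeg (cConj (setof (fun χ => exists ψ, ψ ∈ Ψ /\ χ = cNeg ψ))).

Lemma Rep_and φ ψ l m P Q : Rep φ l P -> Rep ψ m Q ->
  Rep (kAnd φ ψ) (l ++ m) (fun e => P e /\ Q e).
Proof.
intros R1 R2.
assert (Hl : forall i, In i (l ++ m) -> i < 8)
  by (intros i Hi; apply in_app_iff in Hi as [Hi | Hi]; [apply R1 | apply R2]; auto).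
assert (H1 : Rep φ (l ++ m) (Sat φ)).
{ apply (Rep_equiv _ _ _ _ _ R1); [apply incl_appl, incl_refl | exact Hl |].
  intro e; symmetry; apply R1. }
assert (H2 : Rep ψ (l ++ m) (Sat ψ)).
{ apply (Rep_equiv _ _ _ _ _ R2); [apply incl_appr, incl_refl | exact Hl |].
  intro e; symmetry; apply R2. }
apply (Rep_equiv _ (l ++ m) _ (fun e => forall χ, χ ∈ upair φ ψ -> Sat χ e) _);
  [| apply incl_refl | exact Hl |].
- apply Rep_conj; [exact Hl |].
  intros χ Hχ; apply in_upair in Hχ as [-> | ->]; assumption.
- intro e; split.
  + intro H; split; [apply R1 | apply R2]; apply H, in_upair; auto.
  + intros [HP HQ] χ Hχ; apply in_upair in Hχ as [-> | ->];
      [now apply R1 | now apply R2].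
Qed.

Lemma Rep_or φ ψ l m P Q : Rep φ l P -> Rep ψ m Q ->
  Rep (kOr φ ψ) (l ++ m) (fun e => P e \/ Q e).
Proof.
intros R1 R2; assert (R := Rep_neg _ _ _ (Rep_and _ _ _ _ _ _
  (Rep_neg _ _ _ R1) (Rep_neg _ _ _ R2))).
apply (Rep_equiv _ _ _ _ _ R); [apply incl_refl | apply R | intro e; cbv beta; tauto].
Qed.

Lemma Rep_imp φ ψ l m (P Q : env -> Prop) : Rep φ l P -> Rep ψ m Q ->
  Rep (kImp φ ψ) (l ++ m) (fun e => P e -> Q e).
Proof.
intros R1 R2; assert (R := Rep_neg _ _ _ (Rep_and _ _ _ _ _ _
  R1 (Rep_neg _ _ _ R2))).
apply (Rep_equiv _ _ _ _ _ R); [apply incl_refl | apply R | intro e; cbv beta; tauto].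
Qed.

Lemma Rep_iff φ ψ l m P Q : Rep φ l P -> Rep ψ m Q ->
  Rep (kIff φ ψ) ((l ++ m) ++ (m ++ l)) (fun e => P e <-> Q e).
Proof.
intros R1 R2; apply Rep_and; now apply Rep_imp.
Qed.

Lemma Rep_ex i φ l P : i < 8 -> Rep φ l P ->
  Rep (kEx i φ) (remove Nat.eq_dec i l) (fun e => exists b, P (upd e i b)).
Proof.
intros Hi R; assert (R' := Rep_neg _ _ _ (Rep_all i _ _ _ Hi (Rep_neg _ _ _ R))).
apply (Rep_equiv _ _ _ _ _ R'); [apply incl_refl | apply R' |].
intro e; cbv beta; split.
- intro H; apply NNPP; intro H'; apply H; intros b Hb; apply H'; now exists b.
- intros [b Hb] H; exact (H b Hb).
Qed.

Lemma in_image_neg (Ψ χ : V) :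
  χ ∈ setof (fun χ => exists ψ, ψ ∈ Ψ /\ χ = cNeg ψ) <->
  exists ψ, ψ ∈ Ψ /\ χ = cNeg ψ.
Proof.
apply (in_setof (fun χ => exists ψ, ψ ∈ Ψ /\ χ = cNeg ψ)).
destruct (image (fun ψ : V => cNeg ψ) (fun _ => True) Ψ) as [s Hs];
  [def | def |].
exists s; intro z; rewrite Hs; split; intros (ψ & H); exists ψ; tauto.
Qed.

Lemma Rep_disj l Ψ : (forall i, In i l -> i < 8) ->
  (forall ψ, ψ ∈ Ψ -> Rep ψ l (Sat ψ)) ->
  Rep (kDisj Ψ) l (fun e => exists ψ, ψ ∈ Ψ /\ Sat ψ e).
Proof.
intros Hl R.
assert (R' : Rep (kDisj Ψ) l (fun e => ~ forall χ,
  χ ∈ setof (fun χ => exists ψ, ψ ∈ Ψ /\ χ = cNeg ψ) -> Sat χ e)).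
{ apply Rep_neg, Rep_conj; [exact Hl |].
  intros χ Hχ; apply in_image_neg in Hχ as (ψ & Hψ & ->).
  assert (H := Rep_neg _ _ _ (R ψ Hψ)); apply (Rep_equiv _ _ _ _ _ H);
    [apply incl_refl | exact Hl |].
  intro e; symmetry; apply H. }
apply (Rep_equiv _ _ _ _ _ R'); [apply incl_refl | exact Hl |].
intro e; cbv beta; split.
- intro H; apply NNPP; intro H'; apply H; intros χ Hχ.
  apply in_image_neg in Hχ as (ψ & Hψ & ->).
  apply (Rep_neg _ _ _ (R ψ Hψ)); intro Hs; apply H'; eauto.
- intros (ψ & Hψ & Hs) H.
  apply (Rep_neg _ _ _ (R ψ Hψ)) with (e := e); [| exact Hs].
  apply H, in_image_neg; eauto.
Qed.

(** * Formulas with v_0 as their only free variable *)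

Definition Sat1 (φ u : V) : Prop :=
  true_at T φ (adjoin (empty M) ⟨numeral M 0, u⟩).

(* For the formulas considered here, the first condition is equivalent to
   [inf_formula], which is not definable. *)
Definition good (φ : V) : Prop :=
  (exists a, ⟨φ, a⟩ ∈c T \/ ⟨cNeg φ, a⟩ ∈c T) /\
  forall v, free v φ -> v = numeral M 0.

Lemma good_inf φ : good φ -> inf_formula φ.
Proof.
intros [(a & [H | H]) _]; apply (truth_pairs truth_T) in H as (ψ & b & E & H & _);
  apply opair_inj in E as [<- _]; auto using inf_neg_inv.
Qed.

Lemma Sat1_Sat φ e : (forall v, free v φ -> v = numeral M 0) ->
  (Sat1 φ (e 0) <-> Sat φ e).
Proof.
intro Hf; apply true_at_mono; [apply assignment_function | |].
- intros p Hp; apply in_adjoin in Hp as [Hp | ->]; [destruct (in_empty _ Hp) |].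
  apply assignment_pair; split; [lia | reflexivity].
- intros v Hv; rewrite (Hf v Hv); exists (e 0); apply in_adjoin; auto.
Qed.

Lemma Rep_good φ : good φ -> Rep φ [0] (fun e => Sat1 φ (e 0)).
Proof.
intro H; split; [now apply good_inf |]; split; [| split].
- intros v Hv; exists 0; split; [now left | now apply (proj2 H)].
- intros i [<- | []]; lia.
- intro e; symmetry; apply Sat1_Sat; apply H.
Qed.

(** For any valuation, [T] contains the formula or its negation, which yields the first clause of
    [good]. Since at most v_0 is free, a constant environment can stand for every environment with
    the same value at 0. *)
Lemma good_Rep φ l P : Rep φ l P -> (forall i, In i l -> i = 0) ->
  good φ /\ forall u, Sat1 φ u <-> P (fun _ => u).
Proof.
intros R Hl; assert (Hb := Rep_bounded _ _ _ R).
destruct R as (Hi & Hf & _ & H).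
assert (Hf' : forall v, free v φ -> v = numeral M 0)
  by (intros v Hv; destruct (Hf v Hv) as (i & Hin & ->); now rewrite (Hl i Hin)).
split; [split; [| exact Hf'] |].
- destruct (bounded_valuation _ (fun _ => empty M) Hb) as (a & Ha & Hs).
  exists a; destruct (classic (⟨φ, a⟩ ∈c T)) as [HT | HT]; [now left | right].
  apply (truth_neg truth_T); [now apply inf_neg | | exact HT].
  destruct Ha as [Ha Hd]; split; [exact Ha |]; intro v; now rewrite free_neg.
- intro u; rewrite (Sat1_Sat φ (fun _ => u) Hf'); apply H.
Qed.

Lemma good_equiv φ l P (Q : V -> Prop) : Rep φ l P -> (forall i, In i l -> i = 0) ->
  (forall u, P (fun _ => u) <-> Q u) -> good φ /\ forall u, Sat1 φ u <-> Q u.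
Proof.
intros R Hl H; destruct (good_Rep _ _ _ R Hl) as [G HS].
split; [exact G |]; intro u; now rewrite HS.
Qed.

Lemma Def_Sat1 (t u : env -> V) :
  DefT t -> DefT u -> Def (fun e => Sat1 (t e) (u e)).
Proof.
apply (Def_comp2 (fun φ u => Sat1 φ u)); unfold Sat1, true_at; def.
Qed.

Lemma Def_good (t : env -> V) : DefT t -> Def (fun e => good (t e)).
Proof. apply (Def_comp1 (fun φ => good φ)); unfold good; def. Qed.

(* Renames the free variable of [φ] from 0 to [j]. *)
Definition kAt (φ : V) (j : nat) : V := kEx 0 (kAnd (kEq 0 j) φ).

Lemma Rep_at φ j : good φ -> 0 < j < 8 ->
  Rep (kAt φ j) [j] (fun e => Sat1 φ (e j)).
Proof.
intros H Hj.
assert (R := Rep_ex 0 _ _ _ (Nat.lt_0_succ 7) (Rep_and _ _ _ _ _ _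
  (Rep_eq 0 j (Nat.lt_0_succ _) (proj2 Hj)) (Rep_good φ H))).
apply (Rep_equiv _ _ _ _ _ R).
- intros i Hi; apply in_remove in Hi as [Hi Hn]; cbn in Hi; cbn; intuition.
- intros i [<- | []]; lia.
- intro e; split.
  + intros (b & E & Hb); rewrite upd_same in *; rewrite upd_other in E by lia.
    now subst b.
  + intro Hb; exists (e j); now rewrite upd_same, upd_other by lia.
Qed.

(** * Formulas defining pairs, sets and valuations *)

Ltac rep :=
  lazymatch goal with
  | |- _ < 8 => lia
  | |- Rep (kAnd _ _) _ _ => eapply Rep_and; rep
  | |- Rep (kOr _ _) _ _ => eapply Rep_or; rep
  | |- Rep (kImp _ _) _ _ => eapply Rep_imp; rep
  | |- Rep (kIff _ _) _ _ => eapply Rep_iff; rep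
  | |- Rep (cNeg _) _ _ => eapply Rep_neg; rep
  | |- Rep (kAll _ _) _ _ => eapply Rep_all; rep
  | |- Rep (kEx _ _) _ _ => eapply Rep_ex; rep
  | |- Rep (kEq _ _) _ _ => eapply Rep_eq; rep
  | |- Rep (kIn _ _) _ _ => eapply Rep_in; rep
  | |- Rep (cA _) _ _ => eapply Rep_A; rep
  (* Comparing distinct codes up to conversion would unfold their numerals. *)
  | _ =>
      match goal with
      | H : Rep ?φ _ _ |- Rep ?ψ _ _ => constr_eq φ ψ; exact H
      end
  end.

Ltac list8 :=
  let i := fresh in let H := fresh in
  intros i H;
  repeat match goal with
  | H : In _ (remove _ _ _) |- _ => apply in_remove in H as [H ?]
  | H : In _ (_ ++ _) |- _ => apply in_app_iff in H as [H | H]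
  | H : In _ (_ :: _) |- _ => destruct H as [H | H]
  | H : In _ [] |- _ => destruct H
  end; cbn; lia.

(** Kuratowski's definition spelled out: v_6 runs over the members of the pair and v_7 over the
    members of v_6, so p, x and y must stay below 6. *)
Definition kPair (p x y : nat) : V :=
  kAll 6 (kIff (kIn 6 p) (kOr
    (kAll 7 (kIff (kIn 7 6) (kEq 7 x)))
    (kAll 7 (kIff (kIn 7 6) (kOr (kEq 7 x) (kEq 7 y)))))).

Lemma Rep_pair p x y : p < 6 -> x < 6 -> y < 6 ->
  Rep (kPair p x y) [p; x; y] (fun e => e p = ⟨e x, e y⟩).
Proof.
intros Hp Hx Hy.
eapply Rep_equiv; [unfold kPair; rep | list8 | list8 |].
intro e.
assert (E1 : forall a b, upd (upd e 6 a) 7 b 6 = a) by reflexivity.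
assert (E2 : forall a b, upd (upd e 6 a) 7 b 7 = b) by reflexivity.
assert (E3 : forall i, i < 6 -> forall a b, upd (upd e 6 a) 7 b i = e i)
  by (intros i Hi a b; now rewrite !upd_other by lia).
cbv beta.
assert (U : forall a, (forall b, upd (upd e 6 a) 7 b 7 ∈ upd (upd e 6 a) 7 b 6 <->
    upd (upd e 6 a) 7 b 7 = upd (upd e 6 a) 7 b x) <-> a = upair (e x) (e x)).
{ intro a; rewrite <- upair_char; unfold is_upair; split; intros H b; specialize (H b);
    rewrite E1, E2, E3 in *; tauto. }
assert (W : forall a, (forall b, upd (upd e 6 a) 7 b 7 ∈ upd (upd e 6 a) 7 b 6 <->
    upd (upd e 6 a) 7 b 7 = upd (upd e 6 a) 7 b x \/
    upd (upd e 6 a) 7 b 7 = upd (upd e 6 a) 7 b y) <-> a = upair (e x) (e y)).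
{ intro a; rewrite <- upair_char; unfold is_upair; split; intros H b; specialize (H b);
    rewrite E1, E2, !E3 in *; tauto. }
unfold opair; rewrite <- upair_char; unfold is_upair.
split; intros H b; specialize (H b); rewrite U, W in *;
  rewrite upd_same, upd_other in * by lia; exact H.
Qed.

(* A formula defining [c], when [f] contains <b, t> with [t] a formula defining
   [b], for every member [b] of [c]. *)
Definition define_step (p c f : V) : V :=
  kAll 1 (kIff (kIn 1 0)
    (kAt (kDisj (setof (fun t => exists b, b ∈ c /\ ⟨b, t⟩ ∈ f))) 1)).

Lemma DefT_define_step (t u v : env -> V) : DefT t -> DefT u -> DefT v ->
  DefT (fun e => define_step (t e) (u e) (v e)).
Proof.
intros _; apply (DefT_comp2 (fun x f => define_step (empty M) x f)).
unfold define_step, kAt, kAll, kEx, kIff, kImp, kAnd, kDisj, kEq, kIn; def.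
Qed.

Definition define (c : V) : V := recur define_step (empty M) c.

Lemma DefT_define (t : env -> V) : DefT t -> DefT (fun e => define (t e)).
Proof. intro; apply (DefT_recur _ DefT_define_step); def. Qed.

(** By ∈-induction, the disjunction of the formulas defining the members of c defines membership in
    c. The universal formula over v_1 then says that v_0 has exactly these members, and
    extensionality concludes. *)
Lemma define_spec c : good (define c) /\ forall u, Sat1 (define c) u <-> u = c.
Proof.
revert c.
apply (in_ind (fun c => good (define c) /\ forall u, Sat1 (define c) u <-> u = c)).
{ def; [apply Def_good | apply Def_Sat1]; def; apply DefT_define; def. }
intros c IH.
unfold define, recur; fold (define c).
set (Ψ := setof (fun t => exists b, b ∈ c /\
  ⟨b, t⟩ ∈ history define_step (empty M) c)).
assert (HΨ : forall t, t ∈ Ψ <-> exists b, b ∈ c /\ t = define b).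
{ intro t; unfold Ψ; rewrite in_setof.
  - split; intros (b & Hb & Ht); exists b; split; trivial.
    + now apply (history_pair _ DefT_define_step) in Ht.
    + apply (history_pair _ DefT_define_step); split; [now apply in_tc | exact Ht].
  - apply replacement; [def |].
    intros b t1 t2 _ H1 H2; apply (history_pair _ DefT_define_step) in H1 as [_ ->].
    now apply (history_pair _ DefT_define_step) in H2 as [_ ->]. }
assert (R : Rep (kDisj Ψ) [0] (fun e => exists ψ, ψ ∈ Ψ /\ Sat ψ e)).
{ apply Rep_disj; [list8 |].
  intros t Ht; apply HΨ in Ht as (b & Hb & ->).
  assert (Rb := Rep_good _ (proj1 (IH b Hb))); apply (Rep_equiv _ _ _ _ _ Rb);
    [apply incl_refl | list8 |].
  intro e; symmetry; apply Rb. }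
assert (G : good (kDisj Ψ) /\ forall u, Sat1 (kDisj Ψ) u <-> u ∈ c).
{ destruct (good_Rep _ _ _ R) as [G H]; [list8 |].
  split; [exact G |]; intro u; rewrite H; split.
  - intros (ψ & Hψ & Hs); apply HΨ in Hψ as (b & Hb & ->).
    apply (Rep_good _ (proj1 (IH b Hb))), (IH b Hb) in Hs; now subst b.
  - intro Hu; exists (define u); split; [apply HΨ; eauto |].
    now apply (Rep_good _ (proj1 (IH u Hu))), (IH u Hu). }
destruct G as [G H].
assert (R1 := Rep_at _ 1 G ltac:(lia)).
change (define_step (empty M) c (history define_step (empty M) c))
  with (kAll 1 (kIff (kIn 1 0) (kAt (kDisj Ψ) 1))).
assert (R2 : good (kAll 1 (kIff (kIn 1 0) (kAt (kDisj Ψ) 1))) /\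
  forall u, Sat1 (kAll 1 (kIff (kIn 1 0) (kAt (kDisj Ψ) 1))) u <->
    forall b, b ∈ u <-> Sat1 (kDisj Ψ) b).
{ eapply good_equiv; [rep | list8 | reflexivity]. }
destruct R2 as [G' H'].
split; [exact G' |].
intro u; rewrite H'; split.
- intro E; apply ext; intro z; now rewrite (E z), H.
- intros -> z; now rewrite H.
Qed.

Definition kIs (c : V) (j : nat) : V := kAt (define c) j.

Lemma Rep_is c j : 0 < j < 8 -> Rep (kIs c j) [j] (fun e => e j = c).
Proof.
intro Hj; destruct (define_spec c) as [G H]; unfold kIs.
apply (Rep_equiv _ _ _ _ _ (Rep_at _ j G Hj)); [apply incl_refl | list8 |].
intro e; apply H.
Qed.

(** Bound variables are layered to avoid capture: 6 and 7 in [kPair], 5 here, 4 in [kValue], each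
    layer taking its arguments from below its own variable. *)
Definition kPairIn (x y s : nat) : V := kEx 5 (kAnd (kPair 5 x y) (kIn 5 s)).

Lemma Rep_pair_in x y s : x < 5 -> y < 5 -> s < 5 ->
  Rep (kPairIn x y s) [x; y; s] (fun e => ⟨e x, e y⟩ ∈ e s).
Proof.
intros Hx Hy Hs.
assert (R := Rep_pair 5 x y ltac:(lia) ltac:(lia) ltac:(lia)).
eapply Rep_equiv; [unfold kPairIn; rep | list8 | list8 |].
intro e; split.
- intros (p & E & H); rewrite upd_same in *; rewrite !upd_other in * by lia.
  now subst p.
- intro H; exists ⟨e x, e y⟩; rewrite upd_same, !upd_other by lia; auto.
Qed.

Definition kValue (c : V) (j : nat) : V := kEx 4 (kAnd (kIs c 4) (kPairIn 4 j 0)).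

Lemma Rep_value c j : 0 < j < 4 ->
  Rep (kValue c j) [j; 0] (fun e => ⟨c, e j⟩ ∈ e 0).
Proof.
intro Hj; assert (R1 := Rep_is c 4 ltac:(lia)).
assert (R2 := Rep_pair_in 4 j 0 ltac:(lia) ltac:(lia) ltac:(lia)).
eapply Rep_equiv; [unfold kValue; rep | list8 | list8 |].
intro e; split.
- intros (p & E & H); rewrite upd_same in *; rewrite !upd_other in H by lia.
  now subst p.
- intro H; exists c; rewrite upd_same, !upd_other by lia; auto.
Qed.

(** The relation [free] is not expressed in the object language: the set of free variables of φ
    enters as a parameter, named by its defining formula. *)
Definition kVal (φ : V) : V :=
  kAnd
    (kAnd (kAll 2 (kImp (kIn 2 1) (kEx 3 (kEx 4 (kPair 2 3 4)))))
      (kAll 2 (kAll 3 (kAll 4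
        (kImp (kPairIn 2 3 1) (kImp (kPairIn 2 4 1) (kEq 3 4)))))))
    (kAll 2 (kIff (kEx 3 (kPairIn 2 3 1))
      (kEx 4 (kAnd (kIs (free_set φ) 4) (kIn 2 4))))).

Lemma Rep_val φ : fin_formula φ -> Rep (kVal φ) [1] (fun e => is_valuation (e 1) φ).
Proof.
intro Hφ.
assert (R1 := Rep_is (free_set φ) 4 ltac:(lia)).
assert (R2 := Rep_pair 2 3 4 ltac:(lia) ltac:(lia) ltac:(lia)).
assert (R3 := Rep_pair_in 2 3 1 ltac:(lia) ltac:(lia) ltac:(lia)).
assert (R4 := Rep_pair_in 2 4 1 ltac:(lia) ltac:(lia) ltac:(lia)).
eapply Rep_equiv; [unfold kVal; rep | list8 | list8 |].
intro e; cbn; unfold is_valuation, is_function.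
assert (H : forall v, (exists b, b = free_set φ /\ v ∈ b) <-> free v φ).
{ intro v; rewrite <- in_free_set by assumption; split; [| eauto].
  now intros (b & -> & H). }
split; intros [H1 H2]; split; trivial; intro v; rewrite (H2 v), H; reflexivity.
Qed.

Lemma Rep_true φ t : fin_formula φ -> good t ->
  Rep (kAnd (kVal φ) (kAt t 1)) [1]
    (fun e => is_valuation (e 1) φ /\ Sat1 t (e 1)).
Proof.
intros Hφ Ht; assert (R1 := Rep_val φ Hφ); assert (R2 := Rep_at t 1 Ht ltac:(lia)).
eapply Rep_equiv; [rep | list8 | list8 | reflexivity].
Qed.

(** * Translation of the first-order language *)

(* In each translation v_0 stands for the whole valuation. *)
Definition tEq (x y : V) : V := kEx 1 (kAnd (kValue x 1) (kValue y 1)).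
Definition tIn (x y : V) : V :=
  kEx 1 (kEx 2 (kAnd (kAnd (kValue x 1) (kValue y 2)) (kIn 1 2))).
Definition tA (x : V) : V := kEx 1 (kAnd (kValue x 1) (cA (numeral M 1))).
Definition tRestrict (φ t : V) : V :=
  kEx 1 (kAnd (kAll 2 (kImp (kIn 2 1) (kIn 2 0))) (kAnd (kVal φ) (kAt t 1))).
Definition tAnd (φ t ψ s : V) : V := kAnd (tRestrict φ t) (tRestrict ψ s).
(** Here v_3 is the new value b and v_1 the valuation of φ. The clause on v_2 says that v_1 is
    included in the extension of v_0 by the pair of x and b. *)
Definition tAll (x φ t : V) : V :=
  kAll 3 (kEx 1 (kAnd
    (kAll 2 (kImp (kIn 2 1)
      (kOr (kIn 2 0) (kEx 4 (kAnd (kIs x 4) (kPair 2 4 3))))))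
    (kAnd (kVal φ) (kAt t 1)))).
(** One disjunct of the translation of Tr. It includes [kVal φ] because the iterated predicate may
    hold only of valuations. *)
Definition tInstance (x y z α φ t : V) : V :=
  kAnd (kEx 1 (kAnd (kIs α 1) (kValue x 1)))
    (kAnd (kEx 1 (kAnd (kIs φ 1) (kValue y 1)))
      (kEx 1 (kAnd (kValue z 1) (kAnd (kVal φ) (kAt t 1))))).
(* [h] is the set of the triples <α, φ, tr α φ> for the earlier stages α. *)
Definition tTr (x y z h : V) : V :=
  kDisj (setof (fun χ =>
    exists α φ t, ⟨α, φ, t⟩ ∈ h /\ χ = tInstance x y z α φ t)).

Ltac good_rep := eapply good_equiv; [rep | list8 | reflexivity].

Lemma tEq_spec x y : good (tEq x y) /\
  forall a, Sat1 (tEq x y) a <-> exists b, ⟨x, b⟩ ∈ a /\ ⟨y, b⟩ ∈ a.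
Proof.
assert (R1 := Rep_value x 1 ltac:(lia)); assert (R2 := Rep_value y 1 ltac:(lia)).
unfold tEq; good_rep.
Qed.

Lemma tIn_spec x y : good (tIn x y) /\
  forall a, Sat1 (tIn x y) a <->
    exists b c, (⟨x, b⟩ ∈ a /\ ⟨y, c⟩ ∈ a) /\ b ∈ c.
Proof.
assert (R1 := Rep_value x 1 ltac:(lia)); assert (R2 := Rep_value y 2 ltac:(lia)).
unfold tIn; good_rep.
Qed.

Lemma tA_spec x : good (tA x) /\
  forall a, Sat1 (tA x) a <-> exists b, ⟨x, b⟩ ∈ a /\ b ∈c A.
Proof.
assert (R1 := Rep_value x 1 ltac:(lia)); unfold tA; good_rep.
Qed.

Lemma tNeg_spec t : good t -> good (cNeg t) /\
  forall a, Sat1 (cNeg t) a <-> ~ Sat1 t a.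
Proof. intro Ht; assert (R := Rep_good t Ht); good_rep. Qed.

Lemma tAnd_spec φ t ψ s : fin_formula φ -> fin_formula ψ -> good t -> good s ->
  good (tAnd φ t ψ s) /\
  forall a, Sat1 (tAnd φ t ψ s) a <->
    (exists a', subset a' a /\ is_valuation a' φ /\ Sat1 t a') /\
    (exists a', subset a' a /\ is_valuation a' ψ /\ Sat1 s a').
Proof.
intros Hφ Hψ Ht Hs.
assert (R1 := Rep_true φ t Hφ Ht); assert (R2 := Rep_true ψ s Hψ Hs).
(* Naming these conjunctions keeps [rep] from decomposing them, so that it uses [R1] and [R2]. *)
remember (kAnd (kVal φ) (kAt t 1)) as c1 eqn:E1.
remember (kAnd (kVal ψ) (kAt s 1)) as c2 eqn:E2.
unfold tAnd, tRestrict; rewrite <- E1, <- E2; good_rep.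
Qed.

Lemma tAll_spec x φ t : fin_formula φ -> good t ->
  good (tAll x φ t) /\
  forall a, Sat1 (tAll x φ t) a <->
    forall b, exists a', subset a' (adjoin a ⟨x, b⟩) /\
      is_valuation a' φ /\ Sat1 t a'.
Proof.
intros Hφ Ht; assert (R1 := Rep_true φ t Hφ Ht).
assert (R2 := Rep_is x 4 ltac:(lia)).
assert (R3 := Rep_pair 2 4 3 ltac:(lia) ltac:(lia) ltac:(lia)).
remember (kAnd (kVal φ) (kAt t 1)) as c1 eqn:E1.
unfold tAll; rewrite <- E1.
match goal with |- good ?k /\ _ =>
  assert (G : good k /\ forall a, Sat1 k a <-> forall b, exists a',
    (forall p, p ∈ a' -> p ∈ a \/ exists v, v = x /\ p = ⟨v, b⟩) /\
    is_valuation a' φ /\ Sat1 t a') by good_rep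
end.
split; [apply G |]; intro a; rewrite (proj2 G a).
assert (H : forall a' b,
  (forall p, p ∈ a' -> p ∈ a \/ exists v, v = x /\ p = ⟨v, b⟩) <->
  subset a' (adjoin a ⟨x, b⟩)).
{ intros a' b; split; intros H p Hp; specialize (H p Hp);
    rewrite in_adjoin in *; destruct H as [H | H]; auto; right;
    [now destruct H as (v & -> & H) | eauto]. }
split; intros H' b; destruct (H' b) as (a' & H1 & H2); exists a';
  (split; [now apply H | exact H2]).
Qed.

Lemma tInstance_spec x y z α φ t : fin_formula φ -> good t ->
  Rep (tInstance x y z α φ t) [0] (fun e =>
    ⟨x, α⟩ ∈ e 0 /\ ⟨y, φ⟩ ∈ e 0 /\
    exists c, ⟨z, c⟩ ∈ e 0 /\ is_valuation c φ /\ Sat1 t c).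
Proof.
intros Hφ Ht; assert (R1 := Rep_true φ t Hφ Ht).
assert (R2 := Rep_value x 1 ltac:(lia)); assert (R3 := Rep_value y 1 ltac:(lia)).
assert (R4 := Rep_value z 1 ltac:(lia)).
assert (R5 := Rep_is α 1 ltac:(lia)); assert (R6 := Rep_is φ 1 ltac:(lia)).
remember (kAnd (kVal φ) (kAt t 1)) as c1 eqn:E1.
unfold tInstance; rewrite <- E1.
eapply Rep_equiv; [rep | list8 | list8 |].
intro e; cbn.
assert (H : forall v w, (exists b, b = w /\ ⟨v, b⟩ ∈ e 0) <-> ⟨v, w⟩ ∈ e 0).
{ intros v w; split; [now intros (b & -> & H) | eauto]. }
now rewrite !H.
Qed.

Lemma tTr_spec x y z h :
  (forall p, p ∈ h -> exists α φ t,
    p = ⟨α, φ, t⟩ /\ fin_formula φ /\ good t) ->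
  good (tTr x y z h) /\
  forall a, Sat1 (tTr x y z h) a <->
    exists α φ t, ⟨α, φ, t⟩ ∈ h /\ ⟨x, α⟩ ∈ a /\ ⟨y, φ⟩ ∈ a /\
      exists c, ⟨z, c⟩ ∈ a /\ is_valuation c φ /\ Sat1 t c.
Proof.
intro Hh.
assert (Hh' : forall α φ t, ⟨α, φ, t⟩ ∈ h -> fin_formula φ /\ good t).
{ intros α φ t H; destruct (Hh _ H) as (α' & φ' & t' & E & H').
  apply opair_inj in E as [_ E]; now apply opair_inj in E as [-> ->]. }
set (Ψ := setof (fun χ =>
  exists α φ t, ⟨α, φ, t⟩ ∈ h /\ χ = tInstance x y z α φ t)).
assert (HΨ : forall χ, χ ∈ Ψ <->
  exists α φ t, ⟨α, φ, t⟩ ∈ h /\ χ = tInstance x y z α φ t).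
{ unfold Ψ; apply in_setof.
  (* A triple determines its three components, so the relation is functional. *)
  destruct (replacement (fun p χ =>
    exists α φ t, p = ⟨α, φ, t⟩ /\ χ = tInstance x y z α φ t) h) as [s Hs].
  - unfold tInstance, kVal, kValue, kPairIn, kIs, kPair, kAt, kAll, kEx, kIff, kImp,
      kOr, kAnd, kEq, kIn; def;
      repeat (first [simple apply DefT_define | simple apply DefT_free_set]; def).
  - intros p χ χ' _ (α & φ & t & -> & ->) (α' & φ' & t' & E & ->).
    apply opair_inj in E as [-> E]; now apply opair_inj in E as [-> ->].
  - exists s; intro χ; rewrite Hs; split.
    + intros (p & Hp & α & φ & t & -> & ->); eauto.
    + intros (α & φ & t & H & ->); exists ⟨α, φ, t⟩; split; eauto 6. }
assert (R : Rep (kDisj Ψ) [0] (fun e => exists ψ, ψ ∈ Ψ /\ Sat ψ e)).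
{ apply Rep_disj; [list8 |].
  intros χ Hχ; apply HΨ in Hχ as (α & φ & t & H & ->).
  destruct (Hh' _ _ _ H) as [Hφ Ht].
  assert (R := tInstance_spec x y z α φ t Hφ Ht); apply (Rep_equiv _ _ _ _ _ R);
    [apply incl_refl | list8 |].
  intro e; symmetry; apply R. }
destruct (good_Rep _ _ _ R) as [G H]; [list8 |].
split; [exact G |]; intro a; unfold tTr; fold Ψ; rewrite H; split.
- intros (χ & Hχ & Hs); apply HΨ in Hχ as (α & φ & t & Hin & ->).
  destruct (Hh' _ _ _ Hin) as [Hφ Ht].
  apply (tInstance_spec x y z α φ t Hφ Ht) in Hs; eauto 6.
- intros (α & φ & t & Hin & Hs); exists (tInstance x y z α φ t).
  split; [apply HΨ; eauto 6 |].
  destruct (Hh' _ _ _ Hin) as [Hφ Ht].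
  now apply (tInstance_spec x y z α φ t Hφ Ht).
Qed.

(** A case distinction on the outermost constructor of a code, written as a relation. The set f
    holds the translations of the components; h matters for the Tr clause alone. *)
Definition trans_rel (h φ f r : V) : Prop :=
  (exists x y, φ = cEq x y /\ r = tEq x y) \/
  (exists x y, φ = cIn x y /\ r = tIn x y) \/
  (exists x, φ = cA x /\ r = tA x) \/
  (exists x y z, φ = cTr x y z /\ r = tTr x y z h) \/
  (exists ψ t, φ = cNeg ψ /\ ⟨ψ, t⟩ ∈ f /\ r = cNeg t) \/
  (exists ψ t χ s, φ = cAnd ψ χ /\ ⟨ψ, t⟩ ∈ f /\ ⟨χ, s⟩ ∈ f /\
    r = tAnd ψ t χ s) \/
  (exists x ψ t, φ = cAll x ψ /\ ⟨ψ, t⟩ ∈ f /\ r = tAll x ψ t).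

Definition trans_step (h φ f : V) : V := iota (fun r => trans_rel h φ f r).

Lemma DefT_trans_step (t u v : env -> V) : DefT t -> DefT u -> DefT v ->
  DefT (fun e => trans_step (t e) (u e) (v e)).
Proof.
apply (DefT_comp3 (fun h φ f => trans_step h φ f)); unfold trans_step.
apply (DefT_iota (fun r e => trans_rel (e 0) (e 1) (e 2) r)).
unfold trans_rel, tEq, tIn, tA, tTr, tInstance, tAnd, tAll, tRestrict, kVal,
  kValue, kPairIn, kIs, kPair, kDisj, kAt, kAll, kEx, kIff, kImp, kOr, kAnd,
  kEq, kIn; def;
  repeat (first [simple apply DefT_define | simple apply DefT_free_set]; def).
Qed.

Definition trans (h φ : V) : V := recur trans_step h φ.

Lemma DefT_trans (t u : env -> V) :
  DefT t -> DefT u -> DefT (fun e => trans (t e) (u e)).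
Proof. apply (DefT_recur _ DefT_trans_step). Qed.

(** Unique readability: different clauses carry different numerals as tags, within one clause
    pairing is injective, and the history is single-valued. *)
Lemma trans_eq h φ r :
  trans_rel h φ (history trans_step h φ) r -> trans h φ = r.
Proof.
intro H; apply iota_eq; [exact H |].
assert (Hf : forall ψ t t', ⟨ψ, t⟩ ∈ history trans_step h φ ->
  ⟨ψ, t'⟩ ∈ history trans_step h φ -> t = t').
{ intros ψ t t' Ht Ht'.
  apply (history_pair _ DefT_trans_step) in Ht as [_ ->], Ht' as [_ ->]; reflexivity. }
intros r1 r2 [H1 | [H1 | [H1 | [H1 | [H1 | [H1 | H1]]]]]]
  [H2 | [H2 | [H2 | [H2 | [H2 | [H2 | H2]]]]]];
  repeat match goal with
  | H : exists _, _ |- _ => destruct H as [? H]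
  | H : _ /\ _ |- _ => destruct H as [? H]
  end; subst r1 r2 φ; inv_codes.
all: repeat match goal with
  | H : ⟨?ψ, ?t⟩ ∈ history _ _ _, H' : ⟨?ψ, ?t'⟩ ∈ history _ _ _ |- _ =>
      first [constr_eq t t'; clear H' | pose proof (Hf _ _ _ H H'); subst t']
  end; reflexivity.
Qed.

Lemma trans_history h φ ψ : ψ ∈ tc φ ->
  ⟨ψ, trans h ψ⟩ ∈ history trans_step h φ.
Proof. intro H; now apply (history_pair _ DefT_trans_step). Qed.

Lemma trans_Eq h x y : trans h (cEq x y) = tEq x y.
Proof. apply trans_eq; left; now exists x, y. Qed.

Lemma trans_In h x y : trans h (cIn x y) = tIn x y.
Proof. apply trans_eq; right; left; now exists x, y. Qed.

Lemma trans_A h x : trans h (cA x) = tA x.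
Proof. apply trans_eq; do 2 right; left; now exists x. Qed.

Lemma trans_Tr h x y z : trans h (cTr x y z) = tTr x y z h.
Proof. apply trans_eq; do 3 right; left; now exists x, y, z. Qed.

Lemma trans_Neg h φ : trans h (cNeg φ) = cNeg (trans h φ).
Proof.
apply trans_eq; do 4 right; left; exists φ, (trans h φ).
split; [reflexivity |]; split; [apply trans_history, tc_neg | reflexivity].
Qed.

Lemma trans_And h φ ψ :
  trans h (cAnd φ ψ) = tAnd φ (trans h φ) ψ (trans h ψ).
Proof.
apply trans_eq; do 5 right; left; exists φ, (trans h φ), ψ, (trans h ψ).
split; [reflexivity |]; split; [apply trans_history, tc_and_l |].
split; [apply trans_history, tc_and_r | reflexivity].
Qed.

Lemma trans_All h x φ : trans h (cAll x φ) = tAll x φ (trans h φ).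
Proof.
apply trans_eq; do 6 right; exists x, φ, (trans h φ).
split; [reflexivity |]; split; [apply trans_history, tc_all | reflexivity].
Qed.

(** * Iterating the translation along the stages *)

Definition earlier (β f : V) : V :=
  setof (fun q => exists α s, α ∈ β /\ ⟨α, s⟩ ∈ f /\ q ∈ s).

(** A stage is a set of triples naming formulas, so [T] does not enter and set recursion applies.
    The recursion is along ∈ and makes sense for every set β; ordinals are singled out when the
    final class is formed. *)
Definition stage_step (p β f : V) : V :=
  setof (fun q => exists φ, φ ∈ fin_formulas /\
    q = ⟨β, φ, trans (earlier β f) φ⟩).

Lemma DefT_earlier (t u : env -> V) :
  DefT t -> DefT u -> DefT (fun e => earlier (t e) (u e)).
Proof. apply (DefT_comp2 (fun β f => earlier β f)); unfold earlier; def. Qed.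

Lemma DefT_stage_step (t u v : env -> V) : DefT t -> DefT u -> DefT v ->
  DefT (fun e => stage_step (t e) (u e) (v e)).
Proof.
intros _; apply (DefT_comp2 (fun β f => stage_step (empty M) β f)).
unfold stage_step; def; apply DefT_trans; [apply DefT_earlier |]; def.
Qed.

Definition stage (β : V) : V := recur stage_step (empty M) β.

Definition below (β : V) : V := earlier β (history stage_step (empty M) β).

Definition tr (β φ : V) : V := trans (below β) φ.

Lemma DefT_tr (t u : env -> V) :
  DefT t -> DefT u -> DefT (fun e => tr (t e) (u e)).
Proof.
intros Ht Hu; unfold tr, below; apply DefT_trans; [| exact Hu].
apply DefT_earlier; [exact Ht |].
apply (DefT_history _ DefT_stage_step); [def | exact Ht].
Qed.

Lemma in_stage β q :
  q ∈ stage β <-> exists φ, fin_formula φ /\ q = ⟨β, φ, tr β φ⟩.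
Proof.
unfold stage, recur, stage_step at 1; rewrite in_setof.
- split; intros (φ & Hφ & H); exists φ; split; trivial; now apply in_fin_formulas.
- assert (HD : forall t, DefT t -> DefT (fun e : env => tr β (t e)))
    by (intros t Ht; apply DefT_tr; [def | exact Ht]).
  destruct (image (fun φ => ⟨β, φ, tr β φ⟩) (fun _ => True) fin_formulas) as [s Hs];
    [def; apply HD; def | def |].
  exists s; intro z; rewrite Hs; split; intros (φ & H); exists φ;
    unfold tr, below in *; tauto.
Qed.

Lemma in_below β q :
  q ∈ below β <->
  exists α φ, α ∈ β /\ fin_formula φ /\ q = ⟨α, φ, tr α φ⟩.
Proof.
unfold below, earlier; rewrite in_setof.
- split.
  + intros (α & s & Hα & Hs & Hq).
    apply (history_pair _ DefT_stage_step) in Hs as [_ ->].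
    apply in_stage in Hq as (φ & Hφ & ->); eauto.
  + intros (α & φ & Hα & Hφ & ->); exists α, (stage α).
    split; [exact Hα |]; split; [| apply in_stage; eauto].
    apply (history_pair _ DefT_stage_step); split; [now apply in_tc | reflexivity].
- destruct (replacement (fun α s => s = stage α) β) as [T' HT].
  + def; apply (DefT_recur _ DefT_stage_step); def.
  + intros x y y' _ -> ->; reflexivity.
  + exists (union T'); intro q'; rewrite in_union; split.
    * intros (s & Hs & Hq); apply HT in Hs as (α & Hα & ->).
      exists α, (stage α); split; [exact Hα |]; split; [| exact Hq].
      apply (history_pair _ DefT_stage_step); split;
        [now apply in_tc | reflexivity].
    * intros (α & s & Hα & Hs & Hq).
      apply (history_pair _ DefT_stage_step) in Hs as [_ ->].
      exists (stage α); split; [apply HT; eauto | exact Hq].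
Qed.

Lemma below_good β :
  (forall α, α ∈ β -> forall φ, fin_formula φ -> good (tr α φ)) ->
  forall p, p ∈ below β -> exists α φ t,
    p = ⟨α, φ, t⟩ /\ fin_formula φ /\ good t.
Proof.
intros H p Hp; apply in_below in Hp as (α & φ & Hα & Hφ & ->).
exists α, φ, (tr α φ); auto.
Qed.

Lemma tr_good β φ : fin_formula φ -> good (tr β φ).
Proof.
intro Hφ; revert β.
(* The statement is rephrased with the set [fin_formulas] because the predicate of the outer
   induction on β has to be definable. *)
enough (H : forall β φ, φ ∈ fin_formulas -> good (tr β φ))
  by (intro β; now apply H, in_fin_formulas).
clear φ Hφ.
apply (in_ind (fun β => forall φ, φ ∈ fin_formulas -> good (tr β φ))).
{ def; apply Def_good, DefT_tr; def. }
intros β IH φ Hφ; apply in_fin_formulas in Hφ.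
assert (HG : forall p, p ∈ below β -> exists α φ t,
  p = ⟨α, φ, t⟩ /\ fin_formula φ /\ good t).
{ apply below_good; intros α Hα ψ Hψ; apply (IH α Hα); now apply in_fin_formulas. }
clear IH; revert φ Hφ; apply (fin_ind (fun φ => good (tr β φ))); unfold tr.
- apply Def_good, DefT_trans; def.
- intros x y _ _; rewrite trans_Eq; apply tEq_spec.
- intros x y _ _; rewrite trans_In; apply tIn_spec.
- intros x _; rewrite trans_A; apply tA_spec.
- intros x y z _ _ _; rewrite trans_Tr; now apply tTr_spec.
- intros φ _ Hφ; rewrite trans_Neg; now apply tNeg_spec.
- intros φ ψ H1 H2 Hφ Hψ; rewrite trans_And; now apply tAnd_spec.
- intros x φ _ H1 Hφ; rewrite trans_All; now apply tAll_spec.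
Qed.

(** * The iterated truth predicate *)

(** The valuation a becomes the value of v_0. Membership in [fin_formulas] and truth of a formula in
    one variable keep the predicate first-order in [T], so that it determines a class. *)
Definition in_Tr (p : V) : Prop :=
  exists β φ a, p = ⟨β, φ, a⟩ /\ is_ordinal β /\ φ ∈ fin_formulas /\
    is_valuation a φ /\ Sat1 (tr β φ) a.

Lemma fin_neg_inv φ : fin_formula (M := M) (cNeg φ) -> fin_formula φ.
Proof.
intro H; apply fin_inv in H as [H | [H | [H | [H | [H | [H | H]]]]]];
  repeat match goal with
  | H : exists _, _ |- _ => destruct H as [? H]
  | H : _ /\ _ |- _ => destruct H as [? H]
  end; inv_codes; now apply in_fin_formulas.
Qed.

Lemma fin_and_inv φ ψ : fin_formula (M := M) (cAnd φ ψ) ->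
  fin_formula φ /\ fin_formula ψ.
Proof.
intro H; apply fin_inv in H as [H | [H | [H | [H | [H | [H | H]]]]]];
  repeat match goal with
  | H : exists _, _ |- _ => destruct H as [? H]
  | H : _ /\ _ |- _ => destruct H as [? H]
  end; inv_codes; split; now apply in_fin_formulas.
Qed.

Lemma fin_all_inv x φ : fin_formula (M := M) (cAll x φ) -> fin_formula φ.
Proof.
intro H; apply fin_inv in H as [H | [H | [H | [H | [H | [H | H]]]]]];
  repeat match goal with
  | H : exists _, _ |- _ => destruct H as [? H]
  | H : _ /\ _ |- _ => destruct H as [? H]
  end; inv_codes; now apply in_fin_formulas.
Qed.

Lemma iterated_truth_exists :
  exists Tr : classes M, is_iterated_truth_predicate A Tr.
Proof.
destruct (class_of in_Tr) as [Tr HTr].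
{ unfold in_Tr; def; apply Def_Sat1; [apply DefT_tr |]; def. }
assert (HT : forall β φ a, ⟨β, φ, a⟩ ∈c Tr <->
  is_ordinal β /\ fin_formula φ /\ is_valuation a φ /\ Sat1 (tr β φ) a).
{ intros β φ a; rewrite HTr, <- in_fin_formulas; unfold in_Tr; split.
  - intros (β' & φ' & a' & E & H).
    apply opair_inj in E as [-> E]; apply opair_inj in E as [-> ->]; exact H.
  - intro H; exists β, φ, a; split; [reflexivity | exact H]. }
assert (HT' : forall β φ a, is_ordinal β -> fin_formula φ -> is_valuation a φ ->
  (⟨β, φ, a⟩ ∈c Tr <-> Sat1 (tr β φ) a)) by (intros; rewrite HT; tauto).
(* This is the form of restriction built into [tRestrict] and [tAll], so the clauses for conjunction
   and quantifier will match it directly. *)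
assert (HR : forall β φ a, is_ordinal β -> fin_formula φ ->
  (iterated_true_at Tr β φ a <->
   exists a', subset a' a /\ is_valuation a' φ /\ Sat1 (tr β φ) a')).
{ intros β φ a Hβ Hφ; split; intros (a' & H1 & H2 & H3); exists a'.
  - now apply HT' in H3.
  - now rewrite HT'. }
exists Tr; constructor.
- intros t Ht; apply HTr in Ht as (β & φ & a & -> & Hβ & Hφ & Ha & _).
  exists β, φ, a; now rewrite <- in_fin_formulas.
- intros β x y a Hβ Hφ Ha; rewrite HT' by assumption; unfold tr.
  rewrite trans_Eq, (proj2 (tEq_spec x y)); split.
  + intros (b & H1 & H2); exists b, b; auto.
  + intros (b & c & H1 & H2 & <-); eauto.
- intros β x y a Hβ Hφ Ha; rewrite HT' by assumption; unfold tr.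
  rewrite trans_In, (proj2 (tIn_spec x y)); split.
  + intros (b & c & [H1 H2] & H3); eauto.
  + intros (b & c & H1 & H2 & H3); eauto.
- intros β x a Hβ Hφ Ha; rewrite HT' by assumption; unfold tr.
  rewrite trans_A; apply tA_spec.
- intros β x y z a Hβ Hφ Ha; rewrite HT' by assumption; unfold tr.
  (* The disjunction ranges over the triples in [below β], all of whose formulas are good by
     [tr_good] at the earlier stages. *)
  rewrite trans_Tr, (proj2 (tTr_spec x y z (below β)
    (below_good β (fun α _ φ => tr_good α φ)))); split.
  + intros (α & φ & t & H & Hx & Hy & c & Hz & Hc & Hs).
    apply in_below in H as (α' & φ' & Hα & Hf & E).
    apply opair_inj in E as [<- E]; apply opair_inj in E as [<- ->].
    exists α, φ, c.
    split; [exact Hx |]; split; [exact Hy |]; split; [exact Hz |].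
    split; [exact Hα |].
    (* The class contains triples for ordinal stages only, so the earlier stage α must be known to
       be an ordinal. *)
    apply HT; split; [exact (ordinal_in α β Hβ Hα) |].
    split; [exact Hf |]; split; [exact Hc | exact Hs].
  + intros (α & φ & c & Hx & Hy & Hz & Hα & H).
    apply HT in H as (_ & Hf & Hc & Hs).
    exists α, φ, (tr α φ); split; [apply in_below; now exists α, φ |].
    split; [exact Hx |]; split; [exact Hy |]; now exists c.
- intros β φ ψ a Hβ Hφ Ha; rewrite HT' by assumption.
  destruct (fin_and_inv φ ψ Hφ) as [H1 H2]; rewrite !HR by assumption.
  unfold tr at 1; rewrite trans_And; apply tAnd_spec; trivial; now apply tr_good.
- intros β φ a Hβ Hφ Ha; assert (H := fin_neg_inv φ Hφ).
  rewrite HT' by assumption; rewrite HT'; [| assumption | assumption |].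
  + unfold tr at 1; rewrite trans_Neg; apply tNeg_spec; now apply tr_good.
  + destruct Ha as [Ha Hd]; split; [exact Ha |]; intro v; now rewrite Hd, free_neg.
- intros β x φ a Hβ Hφ Ha; assert (H := fin_all_inv x φ Hφ).
  assert (E : tr β (cAll x φ) = tAll x φ (tr β φ)) by (unfold tr; apply trans_All).
  rewrite HT', E by assumption.
  rewrite (proj2 (tAll_spec x φ (tr β φ) H (tr_good β φ H))).
  split; intros H' b; [rewrite HR by assumption; apply H' | apply HR; trivial].
Qed.
End Truth.

Theorem theorem19 (M : GBC_model) (A : classes M) :
  (exists T : classes M, is_truth_predicate A T) ->
  exists Tr : classes M, is_iterated_truth_predicate A Tr.
Proof. intros [T HT]; exact (iterated_truth_exists A T HT). Qed.
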